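(* Let $$F(t,z)=\left(\frac{t}{1+t},\,f_t(z)\right)$$ be holomorphic in a neighborhood of $(0,0)\in\mathbb{C}^2$, where for each $t$ the map $f_t$ is special, i.e. $f_t(z)=z+z^2+z^3+O(z^4)$ as $z\to 0$. For $n\ge 0$ define $$\phi_n(t)=\pi_2F^{n}\left(\frac{t}{1+(n+1)t},\frac{t}{1+nt}\right).$$ Then for all sufficiently small $\epsilon>0$, $\phi_n(t)$ converges for $t$ in $V_\epsilon=\{t\in\mathbb{C}:|t-\epsilon|<\epsilon\}$. Moreover, the limit $\phi$ is a parametrization of the unstable manifold of $f_0$; in particular $$\phi\left(\frac{t}{1-t}\right)=f_0(\phi(t))$$ for all $t\in V_\epsilon$ with $\frac{t}{1-t}\in V_\epsilon$.
   Context: $\pi_2:\mathbb{C}^2\to\mathbb{C}$ is the projection to the second coordinate and $F^n$ is the $n$-th iterate of $F$. The unstable manifold of $f_0$ is the region of points near $0$ whose orbits under the local inverse $f_0^{-1}$ (defined near $0$) converge to $0$. A parametrization of the unstable manifold of $f_0$ on $V_\epsilon$ is an injective holomorphic map $\phi:V_\epsilon\to\mathbb{C}$ with image contained in the unstable manifold of $f_0$ and satisfying $\phi\left(\frac{t}{1-t}\right)=f_0(\phi(t))$ whenever $t$ and $\frac{t}{1-t}$ both lie in $V_\epsilon$. *)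

(* Defs.v *)
From Stdlib Require Import Reals.
From Coquelicot Require Import Coquelicot.

Open Scope C_scope.

Notation C2 := (prod_NormedModule C_AbsRing C_NormedModule C_NormedModule).

(** Holomorphy is C-differentiability at every point: the scalar field of the
    normed modules is [C_AbsRing], so the differential is C-linear. *)
Definition holomorphic_on {E E' : NormedModule C_AbsRing}
    (U : E -> Prop) (F : E -> E') : Prop :=
  forall p : E, U p -> ex_filterdiff F (locally p).

Definition special (h : C -> C) : Prop :=
  exists M : R, locally (0 : C) (fun z : C =>
    (Cmod (h z - (z + z ^ 2 + z ^ 3)) <= M * Cmod z ^ 4)%R).

(** If [skew f] is holomorphic on an open set [U], then [U] contains no point
    with t = -1, so the convention for division by zero plays no role on [U]. *)
Definition skew (f : C -> C -> C) (p : C2) : C2 :=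
  (fst p / (1 + fst p), f (fst p) (snd p)).

(** [F] is only meaningful on [U], hence so is its n-th iterate at [p] only
    when the first n points of the orbit lie in [U]. *)
Definition iter_defined (U : C2 -> Prop) (F : C2 -> C2) (n : nat) (p : C2)
    : Prop :=
  forall k : nat, (k < n)%nat -> U (Nat.iter k F p).

Definition phi_start (n : nat) (t : C) : C2 :=
  (t / (1 + INR (S n) * t), t / (1 + INR n * t)).

Definition phi_seq (f : C -> C -> C) (n : nat) (t : C) : C :=
  snd (Nat.iter n (skew f) (phi_start n t)).

Definition V (eps : R) (t : C) : Prop := (Cmod (t - eps) < eps)%R.

(** [g : W -> N] is the inverse of the restriction [h : N -> W], where [N] and
    [W] are open neighborhoods of 0 and [D] is the domain of [h]. *)
Definition local_inverse (D : C -> Prop) (h : C -> C) (N W : C -> Prop)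
    (g : C -> C) : Prop :=
  open N /\ N 0 /\ open W /\ W 0 /\
  (forall z : C, N z -> D z /\ W (h z) /\ g (h z) = z) /\
  (forall w : C, W w -> N (g w) /\ h (g w) = w).

(** The unstable manifold of [h], for a local inverse [g] of [h] with domain
    [W]: every iterate of [g] must be defined at the point. *)
Definition unstable_manifold (W : C -> Prop) (g : C -> C) (z : C) : Prop :=
  (forall k : nat, W (Nat.iter k g z)) /\
  filterlim (fun k : nat => Nat.iter k g z) eventually (locally (0 : C)).

(** [D] is the domain of [h] and [Wu] its unstable manifold. *)
Definition parametrization (D : C -> Prop) (h : C -> C) (Wu : C -> Prop)
    (Ve : C -> Prop) (phi : C -> C) : Prop :=
  holomorphic_on (E := C_NormedModule) (E' := C_NormedModule) Ve phi /\
  (forall s t : C, Ve s -> Ve t -> phi s = phi t -> s = t) /\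
  (forall t : C, Ve t -> Wu (phi t)) /\
  (forall t : C, Ve t -> Ve (t / (1 - t)) ->
     D (phi t) /\ phi (t / (1 - t)) = h (phi t)).

(* Main.v *)
Require Import Defs.
From Stdlib Require Import Reals Lra Psatz Lia IndefiniteDescription.
From Coquelicot Require Import Coquelicot.

(** Everything happens in the coordinate [w = 1 / z] at infinity.  Because
    [f t z = z + z^2 + z^3 + O(z^4)], the map [G t w = 1 / f t (1 / w)] is
    [w - 1 + O(1 / w^2)]: the coefficient of [z^3] is exactly the one that
    kills the [1 / w] term.  With [tau = 1 / t], the base map becomes
    [tau -> tau + 1], the disc [V eps] becomes the half-plane
    [Re tau > 1 / (2 eps)], and the n-th approximation is the inverse of the
    endpoint of a G-orbit that starts at [tau + n] and makes n steps with
    parameters [1 / (tau + n + 1 + k)].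

    An orbit of the pure translation would end at [tau].  The k-th error is of
    size [1 / (Re tau + n - k)^2], and these numbers have a sum bounded
    independently of n, which is small when [Re tau] is large.  So the orbit
    stays in the half-plane where G is defined ([orbit_region]), and the
    distances between two such orbits change by a bounded factor close to 1
    ([orbit_compare]).  This one comparison gives everything:
    - the orbits [psi_approx] of the single map [G 0] form a Cauchy sequence,
      with a limit [psi] ([psi_approx_cauchy]);
    - the orbits with moving parameters have the same limit, since the
      parameters of the n-th orbit are at most [1 / (n + 1)] and G is Lipschitz
      in the parameter with a constant of size [1 / (Re w)^2]
      ([psi_nonautonomous]);
    - [psi] is injective, since it distorts distances by a factor at most 2
      ([psi_expanding]).
    By construction [psi (tau - 1) = G 0 (psi tau)] ([psi_equation]), and
    [psi tau] is close to [tau], so [phi t = 1 / psi (1 / t)] satisfies the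
    functional equation, and its backward orbit [1 / psi (1 / t + k)] stays near
    0 and tends to 0: it must be the orbit under any given local inverse.

    Three facts of one-variable complex analysis enter.  First, the constant in
    the [O(z^4)] is uniform in t, and G is Lipschitz with the stated constants:
    these are a Schwarz lemma of order 4 ([schwarz_order]) and a Cauchy estimate
    ([cauchy_expansion]), applied in z and in t.  Second, a bounded pointwise
    limit of holomorphic functions is holomorphic ([cdiff_limit]).  Third, a map
    close to the identity has a local inverse ([local_inverse_exists]).
    Since holomorphy is mere complex differentiability, the first two rest on
    Goursat's theorem ([goursat]) and on Cauchy's formula ([cauchy_formula]).
    The contour is the square with vertices [r], [ri], [-r], [-ri], on which
    convexity arguments are elementary; the kernel [1 / (x^n (x - z))] then gives
    the successive divided differences of the function at 0, with bounds.  *)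

Open Scope C_scope.

(** * Complex differentiability in epsilon-delta form *)

Notation cdiff := (@ex_derive C_AbsRing C_NormedModule).
Notation ccont := (@continuous C_UniformSpace C_UniformSpace).

Lemma Cmod_sub_sym x y : Cmod (x - y) = Cmod (y - x).
Proof. rewrite <- (Cmod_opp (x - y)). f_equal. ring. Qed.

Lemma Cmod_sub_triangle x y z : (Cmod (x - z) <= Cmod (x - y) + Cmod (y - z))%R.
Proof. replace (x - z) with ((x - y) + (y - z)) by ring. apply Cmod_triangle. Qed.

Lemma Cmod_sub_le x y : (Cmod (x - y) <= Cmod x + Cmod y)%R.
Proof. rewrite <- (Cmod_opp y). apply Cmod_triangle. Qed.

Lemma Cmod_ge_sub x y : (Cmod x - Cmod y <= Cmod (x - y))%R.
Proof. pose proof (Cmod_triangle (x - y) y) as H. replace (x - y + y) with x in H by ring. lra. Qed.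

Lemma Cmod_pos_neq_0 x : (0 < Cmod x)%R -> x <> 0.
Proof. apply Cmod_gt_0. Qed.

Lemma Cmod_eq_of_small x y : (forall e : R, (0 < e)%R -> (Cmod (x - y) <= e)%R) -> x = y.
Proof.
intros H. assert (Hz : x - y = 0).
{ apply Cmod_eq_0. apply Rle_antisym; [|apply Cmod_ge_0]. apply le_epsilon. intros e He. rewrite Rplus_0_l. auto. }
replace x with ((x - y) + y) by ring. rewrite Hz. ring.
Qed.

(** The neighbourhoods of C are those of the product [R * R], with square
    balls; this is the passage to round balls. *)
Lemma locally_Cmod (z : C) (P : C -> Prop) :
  locally z P <-> exists d : R, (0 < d)%R /\ forall y, (Cmod (y - z) < d)%R -> P y.
Proof.
split.
- intros H. apply locally_C in H. destruct H as [d Hd].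
  exists d. split; [apply cond_pos|]. intros y Hy. apply Hd, Hy.
- intros [d [Hd H]]. apply locally_C. exists (mkposreal d Hd). exact H.
Qed.

Lemma filterlim_Cmod {T} (F : (T -> Prop) -> Prop) {FF : Filter F} (h : T -> C) (l : C) :
  filterlim h F (locally l) <-> forall e : R, (0 < e)%R -> F (fun x => (Cmod (h x - l) < e)%R).
Proof.
split.
- intros H e He. apply (H (fun y => (Cmod (y - l) < e)%R)). apply locally_Cmod. exists e. auto.
- intros H P HP. apply locally_Cmod in HP. destruct HP as [d [Hd HP]].
  unfold filtermap. generalize (H d Hd). apply filter_imp. intros x. apply HP.
Qed.

Lemma continuous_Cmod (h : C -> C) (z : C) :
  ccont h z <-> forall e : R, (0 < e)%R -> exists d : R, (0 < d)%R /\
    forall y, (Cmod (y - z) < d)%R -> (Cmod (h y - h z) < e)%R.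
Proof.
unfold continuous. rewrite (filterlim_Cmod _ h (h z)).
split; intros H e He; specialize (H e He).
- apply locally_Cmod in H. exact H.
- apply locally_Cmod. exact H.
Qed.

Lemma cdiff_iff (h : C -> C) (z : C) :
  cdiff h z <-> exists d : C, forall e : R, (0 < e)%R -> exists del : R, (0 < del)%R /\
    forall y : C, (Cmod (y - z) < del)%R -> (Cmod (h y - h z - d * (y - z)) <= e * Cmod (y - z))%R.
Proof.
split.
- intros [d [_ Hd]].
  exists d; intros e He.
  assert (Hz : is_filter_lim (locally (T:=AbsRing_UniformSpace C_AbsRing) z) z) by (intros P HP; exact HP).
  destruct (Hd z Hz (mkposreal e He)) as [del Hdel].
  exists del; split; [apply cond_pos|].
  intros y Hy.
  specialize (Hdel y Hy). simpl in Hdel.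
  rewrite Cmult_comm. apply Hdel.
- intros [d Hd]. exists d. split.
  + exact (is_linear_scal_l (K:=C_AbsRing) (V:=C_NormedModule) d).
  + intros x Hx e.
    apply (is_filter_lim_locally_unique (V:=AbsRing_NormedModule C_AbsRing)) in Hx. rewrite <- Hx.
    destruct (Hd e (cond_pos e)) as [del [Hdel H]].
    exists (mkposreal del Hdel). intros y Hy.
    specialize (H y Hy). rewrite Cmult_comm in H. exact H.
Qed.

(** C carries two structures of normed module over itself, with different
    uniform structures.  They have the same norm, hence the same derivatives. *)
Lemma cdiff_AbsRing (f : C -> C) (z : C) : cdiff f z <-> ex_derive (K:=C_AbsRing) (V:=AbsRing_NormedModule C_AbsRing) f z.
Proof.
split; intros [l [Hl H]]; exists l; (split; [destruct Hl; split; assumption|exact H]).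
Qed.

Lemma cdiff_mult (f g : C -> C) (z : C) : cdiff f z -> cdiff g z -> cdiff (fun w => f w * g w) z.
Proof.
rewrite !cdiff_AbsRing.
intros [a Ha] [b Hb]. eexists. apply (is_derive_mult (K:=C_AbsRing) f g z a b Ha Hb Cmult_comm).
Qed.

Lemma cdiff_plus (f g : C -> C) (z : C) : cdiff f z -> cdiff g z -> cdiff (fun w => f w + g w) z.
Proof. exact (ex_derive_plus f g z). Qed.

Lemma cdiff_minus (f g : C -> C) (z : C) : cdiff f z -> cdiff g z -> cdiff (fun w => f w - g w) z.
Proof. exact (ex_derive_minus f g z). Qed.

Lemma cdiff_comp (f g : C -> C) (z : C) : cdiff f (g z) -> cdiff g z -> cdiff (fun w => f (g w)) z.
Proof.
intros Hf Hg. apply cdiff_AbsRing in Hg. exact (ex_derive_comp f g z Hf Hg).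
Qed.

Lemma cdiff_id (z : C) : cdiff (fun w => w) z.
Proof. apply cdiff_AbsRing. exact (ex_derive_id z). Qed.

Lemma cdiff_const (a z : C) : cdiff (fun w => a) z.
Proof. exact (ex_derive_const a z). Qed.

Lemma cdiff_inv_id (z : C) : z <> 0 -> cdiff Cinv z.
Proof.
intros Hz. apply cdiff_iff. exists (- / (z * z)). intros e He.
assert (Hm : (0 < Cmod z)%R) by (apply Cmod_gt_0; exact Hz).
set (m := Cmod z) in *.
exists (Rmin (m / 2) (e * m ^ 3 / 2)). split.
{ apply Rmin_pos; [lra|]. pose proof (pow_lt m 3 Hm). nra. }
intros y Hy.
assert (H1 : (Cmod (y - z) < m / 2)%R) by (eapply Rlt_le_trans; [exact Hy|apply Rmin_l]).
assert (H2 : (Cmod (y - z) < e * m ^ 3 / 2)%R) by (eapply Rlt_le_trans; [exact Hy|apply Rmin_r]).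
assert (Hy' : (m / 2 <= Cmod y)%R).
{ pose proof (Cmod_ge_sub z y). rewrite (Cmod_sub_sym z y) in H. unfold m in *. lra. }
assert (Hy0 : y <> 0) by (apply Cmod_gt_0; lra).
replace (/ y - / z - - / (z * z) * (y - z)) with ((y - z) * (y - z) * / (z * z * y)) by (field; auto).
assert (Hn : z * z * y <> 0) by (repeat apply Cmult_neq_0; auto).
rewrite !Cmod_mult, Cmod_inv, !Cmod_mult by auto. fold m.
set (D := Cmod (y - z)) in *.
assert (HD : (0 <= D)%R) by apply Cmod_ge_0.
assert (Hmm : (0 < m * m * Cmod y)%R) by (repeat apply Rmult_lt_0_compat; lra).
apply (Rmult_le_reg_r (m * m * Cmod y)); [lra|].
rewrite Rmult_assoc, Rinv_l, Rmult_1_r by lra.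
assert (Hk : (e * m ^ 3 / 2 <= e * (m * m * Cmod y))%R).
{ replace (e * m ^ 3 / 2)%R with (e * (m * m * (m / 2)))%R by field.
  apply Rmult_le_compat_l; [lra|]. apply Rmult_le_compat_l; [nra|lra]. }
nra.
Qed.

Lemma cdiff_inv (f : C -> C) (z : C) : cdiff f z -> f z <> 0 -> cdiff (fun w => / f w) z.
Proof. intros Hf Hz. apply (cdiff_comp Cinv f); [apply cdiff_inv_id|]; assumption. Qed.

Lemma cdiff_div (f g : C -> C) (z : C) : cdiff f z -> cdiff g z -> g z <> 0 -> cdiff (fun w => f w / g w) z.
Proof. intros Hf Hg Hz. apply (cdiff_mult f (fun w => / g w)); [|apply cdiff_inv]; assumption. Qed.

Lemma cdiff_pow (f : C -> C) (n : nat) (z : C) : cdiff f z -> cdiff (fun w => f w ^ n) z.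
Proof.
intros Hf; induction n; simpl. apply cdiff_const.
apply (cdiff_mult f (fun w => f w ^ n)); assumption.
Qed.

Lemma cdiff_continuous (f : C -> C) (z : C) : cdiff f z -> ccont f z.
Proof.
intros Hf. apply ex_derive_continuous in Hf.
intros P HP. apply locally_C. apply Hf, HP.
Qed.

Lemma cdiff_filterdiff (h : C -> C) (z : C) :
  ex_filterdiff (U:=C_NormedModule) (V:=C_NormedModule) h (locally z) <-> cdiff h z.
Proof.
rewrite ex_derive_filterdiff.
split; intros [l [Hl H]]; exists l; (split; [destruct Hl; split; assumption|]).
- intros x Hx e.  apply locally_C. apply (H x). intros P HP. apply locally_C, Hx, locally_C, HP.
- intros x Hx e.  apply <- locally_C. apply (H x). intros P HP. apply locally_C, Hx, locally_C, HP.
Qed.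

(** * Integrals along segments *)

Notation lerp a b s := (Cplus a (Cmult (RtoC s) (Cminus b a))).
Notation CV := C_R_CompleteNormedModule.

Definition convex (S : C -> Prop) : Prop :=
  forall a b (s : R), S a -> S b -> (0 <= s <= 1)%R -> S (lerp a b s).

Definition cont_on (S : C -> Prop) (u : C -> C) : Prop := forall z, S z -> ccont u z.

(** The contour integral of [u dz] over the segment from [a] to [b]. *)
Definition segint (u : C -> C) (a b : C) : C :=
  RInt (V := CV) (fun s : R => u (lerp a b s)) 0 1 * (b - a).

Lemma continuous_segment (a b : C) (s : R) :
  continuous (T:=R_UniformSpace) (U:=C_UniformSpace) (fun s : R => lerp a b s) s.
Proof.
apply (filterlim_Cmod _ (fun s : R => lerp a b s) (lerp a b s)). intros e He.
set (m := (Cmod (b - a) + 1)%R).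
assert (Hm : (0 < m)%R) by (unfold m; pose proof (Cmod_ge_0 (b - a)); lra).
assert (Hd : (0 < e / m)%R) by (apply Rdiv_lt_0_compat; lra).
exists (mkposreal _ Hd). intros y Hy.
change (Rabs (y - s) < e / m)%R in Hy.
replace (a + y * (b - a) - (lerp a b s)) with (RtoC (y - s) * (b - a)) by (rewrite RtoC_minus; ring).
rewrite Cmod_mult, Cmod_R.
apply Rle_lt_trans with (Rabs (y - s) * m)%R.
{ apply Rmult_le_compat_l; [apply Rabs_pos|unfold m; lra]. }
apply Rlt_le_trans with (e / m * m)%R; [apply Rmult_lt_compat_r; lra|].
right. field. lra.
Qed.

Section Segments.
Variable S : C -> Prop.
Hypothesis HS : convex S.

Lemma ex_RInt_segment u a b : cont_on S u -> S a -> S b ->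
  ex_RInt (V := CV) (fun s : R => u (lerp a b s)) 0 1.
Proof.
intros Hu Ha Hb. apply (ex_RInt_continuous (V:=CV)). intros s Hs.
rewrite Rmin_left, Rmax_right in Hs by lra.
apply (continuous_comp (U:=R_UniformSpace) (V:=C_UniformSpace) (W:=C_UniformSpace)
  (fun s : R => lerp a b s) u).
apply continuous_segment. apply Hu, HS; auto.
Qed.

Lemma ex_RInt_segment_sub u a b p q : cont_on S u -> S a -> S b ->
  (0 <= p <= 1)%R -> (0 <= q <= 1)%R ->
  ex_RInt (V := CV) (fun s : R => u (lerp a b s)) p q.
Proof.
intros Hu Ha Hb Hp Hq. apply (ex_RInt_continuous (V:=CV)). intros s Hs.
apply (continuous_comp (U:=R_UniformSpace) (V:=C_UniformSpace) (W:=C_UniformSpace)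
  (fun s : R => lerp a b s) u).
apply continuous_segment. apply Hu, HS; auto.
revert Hs. unfold Rmin, Rmax. destruct Rle_dec; lra.
Qed.

Lemma segint_bound u a b M : cont_on S u -> S a -> S b ->
  (forall s : R, (0 <= s <= 1)%R -> (Cmod (u (lerp a b s)) <= M)%R) ->
  (Cmod (segint u a b) <= M * Cmod (b - a))%R.
Proof.
intros Hu Ha Hb HM. unfold segint. rewrite Cmod_mult.
apply Rmult_le_compat_r; [apply Cmod_ge_0|].
pose proof (norm_RInt_le_const (V:=C_R_NormedModule) (fun s : R => u (lerp a b s)) 0 1) as H.
specialize (H (RInt (V:=CV) (fun s : R => u (lerp a b s)) 0 1) M Rle_0_1).
rewrite Cmod_norm. rewrite Rminus_0_r, Rmult_1_l in H. apply H.
- intros x Hx. rewrite <- Cmod_norm. auto.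
- apply (RInt_correct (V:=CV)). apply ex_RInt_segment; auto.
Qed.

Lemma segint_plus u v a b : cont_on S u -> cont_on S v -> S a -> S b ->
  segint (fun z => u z + v z) a b = segint u a b + segint v a b.
Proof.
intros Hu Hv Ha Hb. unfold segint.
rewrite (RInt_plus (V:=CV) (fun s : R => u (lerp a b s)) (fun s : R => v (lerp a b s)));
  try (apply ex_RInt_segment; auto).
change plus with Cplus. simpl. ring.
Qed.

Lemma segint_minus u v a b : cont_on S u -> cont_on S v -> S a -> S b ->
  segint (fun z => u z - v z) a b = segint u a b - segint v a b.
Proof.
intros Hu Hv Ha Hb. unfold segint.
rewrite (RInt_minus (V:=CV) (fun s : R => u (lerp a b s)) (fun s : R => v (lerp a b s)));
  try (apply ex_RInt_segment; auto).
change minus with Cminus. simpl. ring.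
Qed.

Lemma lerp_0 a b : lerp a b 0 = a.
Proof. ring. Qed.

Lemma lerp_1 a b : lerp a b 1 = b.
Proof. ring. Qed.

(** An affine change of the parameter.  Reversal and additivity of segment
    integrals are its instances [p = 1, q = 0] and [0, p, 1]. *)
Lemma segint_sub u a b (p q : R) : cont_on S u -> S a -> S b ->
  (0 <= p <= 1)%R -> (0 <= q <= 1)%R ->
  segint u (lerp a b p) (lerp a b q) =
  RInt (V := CV) (fun s : R => u (lerp a b s)) p q * (b - a).
Proof.
intros Hu Ha Hb Hp Hq. unfold segint.
pose proof (RInt_comp_lin (V:=CV) (fun s : R => u (lerp a b s)) (q - p) p 0 1) as H.
replace ((q - p) * 0 + p)%R with p in H by ring.
replace ((q - p) * 1 + p)%R with q in H by ring.
rewrite <- H by (apply ex_RInt_segment_sub; auto). clear H.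
transitivity (scal (q - p)%R (RInt (V:=CV) (fun y : R => u (lerp (lerp a b p) (lerp a b q) y)) 0 1) * (b - a)).
{ rewrite scal_R_Cmult, RtoC_minus. ring. }
f_equal. symmetry.
refine (eq_trans _ (RInt_scal (V:=CV) _ 0 1 (q - p) _)); [|apply ex_RInt_segment; auto].
apply (RInt_ext (V:=CV)). intros x _.
f_equal. f_equal. rewrite RtoC_plus, RtoC_mult, RtoC_minus. ring.
Qed.

Lemma segint_swap u a b : cont_on S u -> S a -> S b -> segint u b a = - segint u a b.
Proof.
intros Hu Ha Hb. pose proof (segint_sub u a b 1 0 Hu Ha Hb) as H.
rewrite lerp_0, lerp_1 in H. rewrite H by lra. unfold segint.
rewrite <- (opp_RInt_swap (V:=CV) _ 0 1) by (apply ex_RInt_segment; auto).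
change opp with Copp. simpl. ring.
Qed.

Lemma segint_Chasles u a b (p : R) : cont_on S u -> S a -> S b -> (0 <= p <= 1)%R ->
  segint u a b = segint u a (lerp a b p) + segint u (lerp a b p) b.
Proof.
intros Hu Ha Hb Hp.
pose proof (segint_sub u a b 0 p Hu Ha Hb) as H0.
pose proof (segint_sub u a b p 1 Hu Ha Hb) as H1.
rewrite lerp_0 in H0. rewrite lerp_1 in H1. rewrite H0, H1 by lra. unfold segint.
rewrite <- (RInt_Chasles (V:=CV) _ 0 p 1) by (apply ex_RInt_segment_sub; auto; lra).
change plus with Cplus. simpl. ring.
Qed.

(** [RInt] is linear over R only, so complex scalars go through the real and
    imaginary parts. *)
Lemma segint_scal u k a b : cont_on S u -> S a -> S b ->
  segint (fun z => k * u z) a b = k * segint u a b.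
Proof.
intros Hu Ha Hb. unfold segint. rewrite Cmult_assoc. f_equal.
apply (is_RInt_unique (V:=CV)).
assert (H := RInt_correct (V:=CV) _ _ _ (ex_RInt_segment u a b Hu Ha Hb)).
set (I := RInt (V:=CV) (fun s : R => u (lerp a b s)) 0 1) in *. clearbody I.
pose proof (is_RInt_fct_extend_fst (U:=R_NormedModule) (V:=R_NormedModule) _ _ _ _ H) as H1.
pose proof (is_RInt_fct_extend_snd (U:=R_NormedModule) (V:=R_NormedModule) _ _ _ _ H) as H2.
apply (is_RInt_fct_extend_pair (U:=R_NormedModule) (V:=R_NormedModule)); simpl.
- apply (is_RInt_minus (V:=R_NormedModule)); apply (is_RInt_scal (V:=R_NormedModule)); assumption.
- apply (is_RInt_plus (V:=R_NormedModule)); apply (is_RInt_scal (V:=R_NormedModule)); assumption.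
Qed.

Lemma segint_ext u v a b : S a -> S b -> (forall z, S z -> u z = v z) -> segint u a b = segint v a b.
Proof.
intros Ha Hb H. unfold segint. f_equal. apply (RInt_ext (V:=CV)).
intros x Hx. rewrite Rmin_left, Rmax_right in Hx by lra. apply H, HS; auto. lra.
Qed.
End Segments.

Lemma segint_const c a b : segint (fun _ => c) a b = c * (b - a).
Proof. unfold segint. rewrite (RInt_const (V:=CV)), scal_R_Cmult. rewrite RtoC_minus. ring. Qed.

Lemma segint_id a b : segint (fun z => z) a b = (b * b - a * a) / 2.
Proof.
(* The mean of [a + s (b - a)] over the unit interval is the midpoint. *)
unfold segint. transitivity ((a + (b - a) / 2) * (b - a)); [|field; intro H; injection H; lra].
f_equal. apply (is_RInt_unique (V:=CV)).
apply (is_RInt_plus (V:=CV)).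
- pose proof (is_RInt_const (V:=C_R_NormedModule) 0 1 a) as H.
  rewrite scal_R_Cmult, RtoC_minus in H. replace ((1 - 0) * a) with a in H by ring. exact H.
- assert (H : is_RInt (V:=R_NormedModule) (fun s : R => s) 0 1 (/2)%R).
  { replace (/2)%R with (minus (1 ^ 2 / 2)%R (0 ^ 2 / 2)%R) by (unfold minus, plus, opp; simpl; field).
    apply (is_RInt_derive (V:=R_CompleteNormedModule) (fun s : R => s ^ 2 / 2)%R (fun s : R => s)).
    - intros x _. auto_derive; auto. field.
    - intros x _. apply continuous_id. }
  set (d := b - a) in *. clearbody d.
  replace (d / 2) with ((scal (fst d) (/2)%R, scal (snd d) (/2)%R) : C)
    by (apply injective_projections; unfold scal; simpl; unfold mult; simpl; field).
  apply (is_RInt_fct_extend_pair (U:=R_NormedModule) (V:=R_NormedModule)).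
  + apply (is_RInt_ext (V:=R_NormedModule) (fun s : R => scal (fst d) s)).
    * intros x _. unfold scal; simpl; unfold mult; simpl. ring.
    * apply (is_RInt_scal (V:=R_NormedModule)), H.
  + apply (is_RInt_ext (V:=R_NormedModule) (fun s : R => scal (snd d) s)).
    * intros x _. unfold scal; simpl; unfold mult; simpl. ring.
    * apply (is_RInt_scal (V:=R_NormedModule)), H.
Qed.

(** * Convergence of complex sequences, and Goursat's theorem for triangles *)

Definition converges (a : nat -> C) (p : C) : Prop :=
  forall d : R, (0 < d)%R -> exists N : nat, forall n, (N <= n)%nat -> (Cmod (a n - p) < d)%R.

Lemma C_cauchy_converges (a : nat -> C) :
  (forall d : R, (0 < d)%R -> exists N : nat, forall n m, (N <= n)%nat -> (N <= m)%nat -> (Cmod (a n - a m) < d)%R) ->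
  exists p, converges a p.
Proof.
intros Ha.
assert (Hc : forall pr : C -> R, (forall z, (Rabs (pr z) <= Cmod z)%R) -> (forall x y : C, pr (x - y)%C = (pr x - pr y)%R) ->
  ex_finite_lim_seq (fun n => pr (a n))).
{ intros pr Hpr Hlin. apply ex_lim_seq_cauchy_corr. intros d.
  destruct (Ha d (cond_pos d)) as [N HN].
  exists N. intros n m Hn Hm. cbv beta. rewrite <- Hlin.
  eapply Rle_lt_trans; [apply Hpr|]. apply HN; assumption. }
destruct (Hc fst) as [p1 H1].
{ intros z. exact (re_le_Cmod z). } { reflexivity. }
destruct (Hc snd) as [p2 H2].
{ intros z. pose proof (Rmax_Cmod z). pose proof (Rmax_r (Rabs (fst z)) (Rabs (snd z))). lra. } { reflexivity. }
exists (p1, p2). intros d Hd.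
assert (Hd2 : (0 < d / 4)%R) by lra.
apply is_lim_seq_spec in H1. apply is_lim_seq_spec in H2.
destruct (H1 (mkposreal _ Hd2)) as [N1 HN1]. destruct (H2 (mkposreal _ Hd2)) as [N2 HN2].
exists (Nat.max N1 N2). intros m Hm.
specialize (HN1 m ltac:(lia)). specialize (HN2 m ltac:(lia)). simpl in HN1, HN2.
eapply Rle_lt_trans; [apply Cmod_2Rmax|].
assert (Hmax : (Rmax (Rabs (fst (a m - (p1, p2))%C)) (Rabs (snd (a m - (p1, p2))%C)) <= d / 4)%R).
{ simpl. apply Rmax_lub; [left; exact HN1|left; exact HN2]. }
assert (Hs : (sqrt 2 <= 2)%R). { rewrite <- (sqrt_Rsqr 2) at 2 by lra. apply sqrt_le_1_alt. unfold Rsqr; lra. }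
pose proof (sqrt_pos 2).
apply Rle_lt_trans with (2 * (d / 4))%R; [|lra].
apply Rmult_le_compat; [lra| |exact Hs|exact Hmax].
eapply Rle_trans; [apply Rabs_pos|apply Rmax_l].
Qed.

Lemma converges_le (a : nat -> C) (p q : C) (e : R) (N : nat) : converges a p ->
  (forall n, (N <= n)%nat -> (Cmod (a n - q) <= e)%R) -> (Cmod (p - q) <= e)%R.
Proof.
intros Hp Hq. apply le_epsilon. intros d Hd. destruct (Hp d Hd) as [N' HN'].
set (m := Nat.max N N'). specialize (HN' m ltac:(unfold m; lia)). specialize (Hq m ltac:(unfold m; lia)).
pose proof (Cmod_sub_triangle p (a m) q) as H. rewrite (Cmod_sub_sym p (a m)) in H. lra.
Qed.

Lemma C_cauchy_lim (a : nat -> C) (e : nat -> R) :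
  (forall n m, (n <= m)%nat -> (Cmod (a m - a n) <= e n)%R) ->
  (forall d : R, (0 < d)%R -> exists n, (e n < d)%R) ->
  exists p, converges a p /\ forall n, (Cmod (a n - p) <= e n)%R.
Proof.
intros Ha He.
destruct (C_cauchy_converges a) as [p Hp].
{ intros d Hd. destruct (He (d / 2)%R) as [N HN]; [lra|]. exists N. intros n m Hn Hm.
  pose proof (Cmod_sub_triangle (a n) (a N) (a m)) as H. rewrite (Cmod_sub_sym (a N)) in H.
  pose proof (Ha _ _ Hn). pose proof (Ha _ _ Hm). lra. }
exists p. split; [exact Hp|]. intros n. rewrite Cmod_sub_sym.
apply (converges_le a p (a n) _ n Hp). intros m Hm. apply Ha, Hm.
Qed.

Lemma dependent_choice {T} (P : T -> Prop) (Q : T -> T -> Prop) t0 :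
  (forall t, P t -> exists t', P t' /\ Q t t') -> P t0 ->
  exists s : nat -> T, s O = t0 /\ forall n, P (s n) /\ Q (s n) (s (S n)).
Proof.
intros H H0.
assert (Hf : forall x : sig P, exists y : sig P, Q (proj1_sig x) (proj1_sig y)).
{ intros [t Ht]. destruct (H t Ht) as [t' [Ht' HQ]]. exists (exist _ t' Ht'). exact HQ. }
destruct (functional_choice _ Hf) as [f Hf'].
exists (fun n => proj1_sig (Nat.iter n f (exist _ t0 H0))). split; [reflexivity|].
intros n. split; [apply proj2_sig|]. simpl. apply Hf'.
Qed.

Definition triangle_int (u : C -> C) (a b c : C) : C := segint u a b + segint u b c + segint u c a.

Definition perim (a b c : C) : R := (Cmod (b - a) + Cmod (c - b) + Cmod (a - c))%R.

Lemma perim_ge_0 a b c : (0 <= perim a b c)%R.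
Proof. unfold perim. pose proof (Cmod_ge_0 (b - a)). pose proof (Cmod_ge_0 (c - b)). pose proof (Cmod_ge_0 (a - c)). lra. Qed.

Lemma convex_and S1 S2 : convex S1 -> convex S2 -> convex (fun z => S1 z /\ S2 z).
Proof. intros H1 H2 a b s [Ha1 Ha2] [Hb1 Hb2] Hs. split; auto. Qed.

Lemma convex_ball p r : convex (fun z => (Cmod (z - p) <= r)%R).
Proof.
intros a b s Ha Hb Hs. replace (lerp a b s - p) with (RtoC (1 - s) * (a - p) + RtoC s * (b - p)) by (rewrite RtoC_minus; ring).
eapply Rle_trans; [apply Cmod_triangle|]. rewrite !Cmod_mult, !Cmod_R, !Rabs_pos_eq by lra. nra.
Qed.

Lemma triangle_int_bound S u a b c M : convex S -> cont_on S u -> S a -> S b -> S c ->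
  (forall z, S z -> (Cmod (u z) <= M)%R) -> (Cmod (triangle_int u a b c) <= M * perim a b c)%R.
Proof.
intros HS Hu Ha Hb Hc HM. unfold triangle_int, perim.
pose proof (segint_bound S HS u a b M Hu Ha Hb (fun s Hs => HM _ (HS _ _ _ Ha Hb Hs))).
pose proof (segint_bound S HS u b c M Hu Hb Hc (fun s Hs => HM _ (HS _ _ _ Hb Hc Hs))).
pose proof (segint_bound S HS u c a M Hu Hc Ha (fun s Hs => HM _ (HS _ _ _ Hc Ha Hs))).
eapply Rle_trans; [apply Cmod_triangle|].
pose proof (Cmod_triangle (segint u a b) (segint u b c)). lra.
Qed.

Lemma Ctwo_neq_0 : RtoC 2 <> 0.
Proof. intro H. injection H. lra. Qed.

Lemma cont_on_affine S p q : cont_on S (fun z => p + q * z).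
Proof.
intros z _. apply cdiff_continuous, (cdiff_plus (fun _ => p) (fun z => q * z)); [apply cdiff_const|].
apply (cdiff_mult (fun _ => q) (fun z => z)); [apply cdiff_const|apply cdiff_id].
Qed.

Lemma convex_True : convex (fun _ => True).
Proof. intros a b s _ _ _. exact I. Qed.

Lemma segint_affine p q a b : segint (fun z => p + q * z) a b = p * (b - a) + q * (b * b - a * a) / 2.
Proof.
assert (Hid : cont_on (fun _ => True) (fun z => z)) by (intros z _; apply cdiff_continuous, cdiff_id).
assert (Hc : cont_on (fun _ => True) (fun _ => p)) by (intros z _; apply cdiff_continuous, cdiff_const).
assert (Hq : cont_on (fun _ => True) (fun z => q * z)).
{ intros z _. apply cdiff_continuous, (cdiff_mult (fun _ => q) (fun z => z)); [apply cdiff_const|apply cdiff_id]. }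
rewrite (segint_plus _ convex_True _ _ a b Hc Hq I I).
rewrite segint_const, (segint_scal _ convex_True _ q a b Hid I I), segint_id. field.
Qed.

Lemma triangle_int_affine p q a b c : triangle_int (fun z => p + q * z) a b c = 0.
Proof. unfold triangle_int. rewrite !segint_affine. field. Qed.

Lemma Cmod_half z : Cmod (z / 2) = (Cmod z / 2)%R.
Proof. rewrite Cmod_div by apply Ctwo_neq_0. rewrite Cmod_R, Rabs_pos_eq by lra. reflexivity. Qed.

(** The three midpoints cut the triangle into four, and the integrals over the
    inner sides cancel; one of the four parts carries at least a quarter of the
    integral. *)
Lemma triangle_int_bisect S u a b c : convex S -> cont_on S u -> S a -> S b -> S c ->
  exists a' b' c', (S a' /\ S b' /\ S c') /\ perim a' b' c' = (perim a b c / 2)%R /\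
    (Cmod (triangle_int u a b c) <= 4 * Cmod (triangle_int u a' b' c'))%R /\ (Cmod (a' - a) <= perim a b c)%R.
Proof.
intros HS Hu Ha Hb Hc.
set (ab := lerp a b (/2)%R). set (bc := lerp b c (/2)%R). set (ca := lerp c a (/2)%R).
assert (Hab : S ab) by (apply HS; auto; lra).
assert (Hbc : S bc) by (apply HS; auto; lra).
assert (Hca : S ca) by (apply HS; auto; lra).
assert (Hsplit : triangle_int u a b c = triangle_int u a ab ca + triangle_int u ab b bc + triangle_int u ca bc c + triangle_int u bc ca ab).
{ unfold triangle_int. rewrite (segint_Chasles S HS u a b (/2)%R), (segint_Chasles S HS u b c (/2)%R), (segint_Chasles S HS u c a (/2)%R) by (auto; lra).
  fold ab bc ca.
  rewrite (segint_swap S HS u ca ab), (segint_swap S HS u ab bc), (segint_swap S HS u bc ca) by auto. ring. }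
assert (E : RtoC (/2)%R = / 2) by (apply RtoC_inv; lra).
assert (Hsum : (Cmod (triangle_int u a b c) <= Cmod (triangle_int u a ab ca) + Cmod (triangle_int u ab b bc) + Cmod (triangle_int u ca bc c) + Cmod (triangle_int u bc ca ab))%R).
{ rewrite Hsplit. eapply Rle_trans; [apply Cmod_triangle|apply Rplus_le_compat_r].
  eapply Rle_trans; [apply Cmod_triangle|apply Rplus_le_compat_r]. apply Cmod_triangle. }
assert (Hp : forall x y z w : C, x - y = (z - w) / 2 -> Cmod (x - y) = (Cmod (z - w) / 2)%R).
{ intros x y z w H. rewrite H. apply Cmod_half. }
assert (Hpos : (0 <= Cmod (b - a) /\ 0 <= Cmod (c - b) /\ 0 <= Cmod (a - c))%R) by (repeat split; apply Cmod_ge_0).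
assert (P1 : Cmod (ab - a) = (Cmod (b - a) / 2)%R) by (apply Hp; unfold ab; rewrite E; field).
assert (P2 : Cmod (b - ab) = (Cmod (b - a) / 2)%R) by (apply Hp; unfold ab; rewrite E; field).
assert (P3 : Cmod (bc - b) = (Cmod (c - b) / 2)%R) by (apply Hp; unfold bc; rewrite E; field).
assert (P4 : Cmod (c - bc) = (Cmod (c - b) / 2)%R) by (apply Hp; unfold bc; rewrite E; field).
assert (P5 : Cmod (ca - c) = (Cmod (a - c) / 2)%R) by (apply Hp; unfold ca; rewrite E; field).
assert (P6 : Cmod (a - ca) = (Cmod (a - c) / 2)%R) by (apply Hp; unfold ca; rewrite E; field).
assert (P7 : Cmod (ca - ab) = (Cmod (c - b) / 2)%R) by (apply Hp; unfold ca, ab; rewrite E; field).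
assert (P8 : Cmod (ab - bc) = (Cmod (a - c) / 2)%R) by (apply Hp; unfold bc, ab; rewrite E; field).
assert (P9 : Cmod (bc - ca) = (Cmod (b - a) / 2)%R) by (apply Hp; unfold bc, ca; rewrite E; field).
assert (HD : forall x, (Cmod (triangle_int u a b c) <= 4 * x)%R \/ (x < Cmod (triangle_int u a b c) / 4)%R) by (intros x; lra).
unfold perim at 2 3.
destruct (HD (Cmod (triangle_int u a ab ca))) as [H1|H1].
{ exists a, ab, ca. unfold perim. repeat split; auto; try lra. replace (a - a) with (RtoC 0) by ring. rewrite Cmod_0; lra. }
destruct (HD (Cmod (triangle_int u ab b bc))) as [H2|H2].
{ exists ab, b, bc. unfold perim. repeat split; auto; lra. }
destruct (HD (Cmod (triangle_int u ca bc c))) as [H3|H3].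
{ exists ca, bc, c. unfold perim. repeat split; auto; try lra.
  rewrite Cmod_sub_sym. lra. }
destruct (HD (Cmod (triangle_int u bc ca ab))) as [H4|H4]; [|lra].
exists bc, ca, ab. unfold perim. repeat split; auto; try lra.
- rewrite (Cmod_sub_sym ca bc), (Cmod_sub_sym ab ca), (Cmod_sub_sym bc ab). lra.
- pose proof (Cmod_sub_triangle bc ab a). rewrite (Cmod_sub_sym ab bc) in P8. lra.
Qed.

(** Closedness, in the form in which it is applied to the limit of the nested
    triangles. *)
Definition adherent_closed (S : C -> Prop) : Prop :=
  forall p, (forall e : R, (0 < e)%R -> exists q, S q /\ (Cmod (q - p) < e)%R) -> S p.

Lemma pow_half_small (L d : R) : (0 < d)%R -> exists n, (L * (1/2) ^ n < d)%R.
Proof.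
intros Hd. destruct (Rle_or_lt L 0) as [H|H].
{ exists O. simpl. lra. }
destruct (pow_lt_1_zero (1/2) ltac:(rewrite Rabs_pos_eq; lra) (d / L)) as [N HN].
{ apply Rdiv_lt_0_compat; lra. }
exists N. specialize (HN N (Nat.le_refl _)). rewrite Rabs_pos_eq in HN by (apply pow_le; lra).
apply (Rmult_lt_compat_l L) in HN; [|lra]. replace (L * (d / L))%R with d in HN by (field; lra). exact HN.
Qed.

(** Bisection produces nested triangles of perimeter [L / 2^n] whose integrals
    are at least [4^-n] times the original one, and which shrink to a point [p]
    of the set.  Near [p] the function is affine up to [e * |z - p|]; the affine
    part integrates to 0, and the rest contributes at most
    [e * (3 L / 2^n) * (L / 2^n)].  So the original integral is at most
    [3 e L^2] for every [e]. *)
Theorem goursat K u a b c : convex K -> adherent_closed K -> (forall z, K z -> cdiff u z) ->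
  K a -> K b -> K c -> triangle_int u a b c = 0.
Proof.
intros HS Hcl Hd Ha Hb Hc.
assert (Hu : cont_on K u) by (intros z Hz; apply cdiff_continuous, Hd, Hz).
set (L := perim a b c).
destruct (dependent_choice
  (fun t => K (fst (fst t)) /\ K (snd (fst t)) /\ K (snd t))
  (fun t t' : C * C * C => let '(a, b, c) := t in let '(a', b', c') := t' in
     perim a' b' c' = (perim a b c / 2)%R /\
    (Cmod (triangle_int u a b c) <= 4 * Cmod (triangle_int u a' b' c'))%R /\ (Cmod (a' - a) <= perim a b c)%R) (a, b, c))
  as [s [Hs0 Hs]].
{ intros [[x y] z] [Hx [Hy Hz]]. simpl in *.
  destruct (triangle_int_bisect K u x y z HS Hu Hx Hy Hz) as [x' [y' [z' [H1 H2]]]].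
  exists (x', y', z'). auto. }
{ simpl; auto. }
set (A n := fst (fst (s n))). set (B n := snd (fst (s n))). set (D n := snd (s n)).
assert (HSn : forall n, K (A n) /\ K (B n) /\ K (D n)) by (intros n; apply Hs).
assert (HQ : forall n, perim (A (S n)) (B (S n)) (D (S n)) = (perim (A n) (B n) (D n) / 2)%R /\
    (Cmod (triangle_int u (A n) (B n) (D n)) <= 4 * Cmod (triangle_int u (A (S n)) (B (S n)) (D (S n))))%R /\
    (Cmod (A (S n) - A n) <= perim (A n) (B n) (D n))%R).
{ intros n. destruct (Hs n) as [_ H]. unfold A, B, D. destruct (s n) as [[x y] z], (s (S n)) as [[x' y'] z']. exact H. }
assert (HL : forall n, perim (A n) (B n) (D n) = (L * (1/2) ^ n)%R).
{ induction n. - unfold A, B, D. rewrite Hs0. simpl. unfold L. ring.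
  - destruct (HQ n) as [H _]. rewrite H, IHn. simpl. field. }
assert (HK : forall n, (Cmod (triangle_int u a b c) * (1/2) ^ n * (1/2) ^ n <= Cmod (triangle_int u (A n) (B n) (D n)))%R).
{ induction n. - unfold A, B, D. rewrite Hs0. simpl. lra.
  - destruct (HQ n) as [_ [H _]]. simpl. lra. }
assert (HL0 : (0 <= L)%R) by apply perim_ge_0.
assert (Hpw : forall n, (0 < (1/2) ^ n)%R) by (intros n; apply pow_lt; lra).
destruct (C_cauchy_lim A (fun n => 2 * L * (1/2) ^ n)%R) as [p [_ Hp]].
{ intros n m Hnm. assert (H : (Cmod (A m - A n) <= 2 * L * (1/2) ^ n - 2 * L * (1/2) ^ m)%R).
  { induction Hnm.
    - replace (A n - A n) with (RtoC 0) by ring. rewrite Cmod_0. lra.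
    - destruct (HQ m) as [_ [_ H]]. rewrite HL in H.
      pose proof (Cmod_sub_triangle (A (S m)) (A m) (A n)). simpl. lra. }
  pose proof (Hpw m). nra. }
{ intros d Hd0. apply pow_half_small; auto. }
assert (HSp : K p).
{ apply Hcl. intros e He. destruct (pow_half_small (2 * L) e He) as [n Hn]. exists (A n). split; [apply HSn|].
  pose proof (Hp n). simpl in H. lra. }
pose proof (Hd p HSp) as Hdp. apply cdiff_iff in Hdp. destruct Hdp as [d Hdd].
apply Cmod_eq_0. apply Rle_antisym; [|apply Cmod_ge_0].
apply le_epsilon. intros e He. rewrite Rplus_0_l.
set (e' := (e / (3 * L * L + 1))%R).
assert (He' : (0 < e')%R) by (apply Rdiv_lt_0_compat; nra).
destruct (Hdd e' He') as [del [Hdel Hdd']].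
destruct (pow_half_small (3 * L) del Hdel) as [n Hn].
destruct (HSn n) as [HA [HB HD]].
pose proof (HK n) as HKn. pose proof (Hpw n) as Hpn. pose proof (Hp n) as Hpn'. simpl in Hpn'.
pose proof (HL n) as HLn.
set (q := ((1/2) ^ n)%R) in *.
pose (K' := fun z => K z /\ (Cmod (z - p) <= 3 * L * q)%R).
assert (HS' : convex K') by (apply convex_and; [exact HS|apply convex_ball]).
assert (Hpe : (Cmod (B n - A n) <= L * q /\ Cmod (D n - A n) <= L * q)%R).
{ unfold perim in HLn. pose proof (Cmod_ge_0 (B n - A n)). pose proof (Cmod_ge_0 (D n - B n)). pose proof (Cmod_ge_0 (A n - D n)).
  rewrite (Cmod_sub_sym (D n) (A n)). lra. }
assert (HA' : K' (A n)). { split; auto. nra. }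
assert (HB' : K' (B n)). { split; auto. pose proof (Cmod_sub_triangle (B n) (A n) p). lra. }
assert (HD' : K' (D n)). { split; auto. pose proof (Cmod_sub_triangle (D n) (A n) p). lra. }
pose (w := fun z => u z - ((u p - d * p) + d * z)).
assert (Hw : cont_on K' w).
{ intros z [Hz _]. apply cdiff_continuous, (cdiff_minus u); [apply Hd, Hz|].
  apply (cdiff_plus (fun _ => u p - d * p) (fun z => d * z)); [apply cdiff_const|].
  apply (cdiff_mult (fun _ => d) (fun z => z)); [apply cdiff_const|apply cdiff_id]. }
assert (Htri : triangle_int u (A n) (B n) (D n) = triangle_int w (A n) (B n) (D n)).
{ assert (Hu' : cont_on K' u) by (intros z [Hz _]; auto).
  pose proof (cont_on_affine K' (u p - d * p) d) as Haf.
  unfold w, triangle_int. rewrite !(segint_minus K' HS' u (fun z => u p - d * p + d * z)) by auto.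
  pose proof (triangle_int_affine (u p - d * p) d (A n) (B n) (D n)) as H0. unfold triangle_int in H0.
  transitivity (segint u (A n) (B n) + segint u (B n) (D n) + segint u (D n) (A n) - 0); [ring|].
  rewrite <- H0. ring. }
rewrite Htri in HKn.
assert (Hb' : (Cmod (triangle_int w (A n) (B n) (D n)) <= e' * (3 * L * q) * perim (A n) (B n) (D n))%R).
{ apply (triangle_int_bound K'); auto. intros z [Hz Hzp]. unfold w.
  replace (u z - (u p - d * p + d * z)) with (u z - u p - d * (z - p)) by ring.
  eapply Rle_trans; [apply Hdd'; lra|]. apply Rmult_le_compat_l; lra. }
rewrite HLn in Hb'.
assert (Hfin : (Cmod (triangle_int u a b c) * (q * q) <= (e' * (3 * L * L)) * (q * q))%R) by lra.
apply Rmult_le_reg_r in Hfin; [|nra].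
assert (e' * (3 * L * L + 1) = e)%R by (unfold e'; field; nra).
nra.
Qed.

(** * Cauchy's formula on a square *)

(** A disc cut by a half-plane.  These sets are convex and closed, and they avoid
    [z] when [m > 0], so they are the domains on which Goursat's theorem is
    applied to functions singular at [z]. *)
Definition cap (k c : C) (r : R) (z : C) (m : R) (x : C) : Prop :=
  (Cmod (x - c) <= r /\ m <= Re (k * (x - z)))%R.

Lemma Re_le_Cmod k x : (Rabs (Re (k * x)%C) <= Cmod k * Cmod x)%R.
Proof. rewrite <- Cmod_mult. apply re_le_Cmod. Qed.

Lemma convex_cap k c r z m : convex (cap k c r z m).
Proof.
apply (convex_and (fun x => (Cmod (x - c) <= r)%R)); [apply convex_ball|].
intros a b s Ha Hb Hs.
replace (k * (lerp a b s - z)) with (RtoC (1 - s) * (k * (a - z)) + RtoC s * (k * (b - z))) by (rewrite RtoC_minus; ring).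
unfold Re in *. set (A := k * (a - z)) in *. set (B := k * (b - z)) in *. clearbody A B. simpl. nra.
Qed.

Lemma adherent_closed_cap k c r z m : adherent_closed (cap k c r z m).
Proof.
intros p Hp. split.
- apply le_epsilon. intros e He. destruct (Hp e He) as [q [[Hq _] Hqp]].
  pose proof (Cmod_sub_triangle p q c) as H. rewrite (Cmod_sub_sym p q) in H. lra.
- apply le_epsilon. intros e He.
  assert (HK : (0 < Cmod k + 1)%R) by (pose proof (Cmod_ge_0 k); lra).
  destruct (Hp (e / (Cmod k + 1))%R) as [q [[_ Hq] Hqp]]; [apply Rdiv_lt_0_compat; lra|].
  pose proof (Re_le_Cmod k (q - p)) as H.
  assert (Hkq : (Cmod k * Cmod (q - p) <= e)%R).
  { apply (Rmult_lt_compat_l _ _ _ HK) in Hqp. replace ((Cmod k + 1) * (e / (Cmod k + 1)))%R with e in Hqp by (field; lra).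
    pose proof (Cmod_ge_0 (q - p)). lra. }
  replace (k * (q - z)) with (k * (p - z) + k * (q - p)) in Hq by ring.
  unfold Re in *. set (A := k * (p - z)) in *. set (B := k * (q - p)) in *. clearbody A B. simpl in Hq.
  pose proof (Rle_abs (fst B)). lra.
Qed.

Lemma cap_neq k c r z m x : (0 < m)%R -> cap k c r z m x -> x <> z.
Proof.
intros Hm [_ H] E. subst x. replace (k * (z - z)) with (RtoC 0) in H by ring. unfold Re in H. simpl in H. lra.
Qed.

(** A side [w, w'] of the square with vertices [1, i, -1, -i].  The real-linear
    form [x -> Re (k x)] equals 1 along the whole side; it serves to separate the
    side from points inside the square. *)
Definition is_side (w w' k : C) : Prop :=
  Cmod w = 1%R /\ Cmod w' = 1%R /\ (Cmod k <= 3 / 2)%R /\ Re (k * w) = 1%R /\ Re (k * w') = 1%R /\ w' = Ci * w.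

Lemma Cmod_signs a b : (a * a = 1)%R -> (b * b = 1)%R -> (Cmod (a, b) <= 3 / 2)%R.
Proof.
intros Ha Hb. unfold Cmod; simpl. rewrite !Rmult_1_r, Ha, Hb.
rewrite <- (sqrt_Rsqr (3/2)) by lra. apply sqrt_le_1_alt. unfold Rsqr; lra.
Qed.

Lemma sides : is_side 1 Ci (1, -1)%R /\ is_side Ci (-1) (-1, -1)%R /\
  is_side (-1) (-Ci) (-1, 1)%R /\ is_side (-Ci) 1 (1, 1)%R.
Proof.
unfold is_side. rewrite !Cmod_opp, !Cmod_1, !Cmod_Ci.
repeat split; try (apply Cmod_signs; ring); try (simpl; ring); try (apply injective_projections; simpl; ring);
  rewrite Cmod_R, Rabs_left; lra.
Qed.

Definition diamond_int (u : C -> C) (p : C) (r : R) : C :=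
  segint u (p + r * 1) (p + r * Ci) + segint u (p + r * Ci) (p + r * (-1)) +
  segint u (p + r * (-1)) (p + r * (-Ci)) + segint u (p + r * (-Ci)) (p + r * 1).

(** The trapezoid between a side of the outer square and the parallel side of the
    small square around [z] is the union of two triangles in a cap that avoids
    [z].  Its boundary integral therefore vanishes. *)
Lemma side_shrink (u : C -> C) (z w w' k : C) (r s : R) : is_side w w' k ->
  (0 < s < r / 4)%R -> (Cmod z <= r / 2)%R ->
  (forall x, (Cmod x <= r)%R -> x <> z -> cdiff u x) ->
  segint u (0 + r * w) (0 + r * w') - segint u (z + s * w) (z + s * w') =
  segint u (0 + r * w) (z + s * w) - segint u (0 + r * w') (z + s * w').
Proof.
intros [Hw [Hw' [Hk [Hkw [Hkw' _]]]]] Hs Hz Hu.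
set (S := cap k 0 r z s).
assert (HS : convex S) by apply convex_cap.
assert (Hcl : adherent_closed S) by apply adherent_closed_cap.
assert (Hd : forall x, S x -> cdiff u x).
{ intros x Hx. apply Hu. destruct Hx as [Hx _]. replace (x - 0) with x in Hx by ring. exact Hx.
  apply (cap_neq k 0 r z s); [lra|exact Hx]. }
assert (Hc : cont_on S u) by (intros x Hx; apply cdiff_continuous, Hd, Hx).
assert (Hlz : (Re (k * z)%C <= 3 / 4 * r)%R).
{ pose proof (Re_le_Cmod k z). pose proof (Rle_abs (Re (k * z)%C)). pose proof (Cmod_ge_0 z). pose proof (Cmod_ge_0 k). nra. }
assert (HA : forall w0 : C, Cmod w0 = 1%R -> Re (k * w0) = 1%R -> S (0 + r * w0)).
{ intros w0 H1 H2. split.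
  - replace (0 + r * w0 - 0) with (r * w0) by ring. rewrite Cmod_mult, Cmod_R, H1, Rabs_pos_eq by lra. lra.
  - replace (k * (0 + r * w0 - z)) with (r * (k * w0) - k * z) by ring.
    unfold Re in *. simpl in *. nra. }
assert (HB : forall w0 : C, Cmod w0 = 1%R -> Re (k * w0) = 1%R -> S (z + s * w0)).
{ intros w0 H1 H2. split.
  - replace (z + s * w0 - 0) with (z + s * w0) by ring.
    eapply Rle_trans; [apply Cmod_triangle|]. rewrite Cmod_mult, Cmod_R, H1, Rabs_pos_eq by lra. lra.
  - replace (k * (z + s * w0 - z)) with (s * (k * w0)) by ring.
    unfold Re in *. simpl in *. nra. }
set (A := 0 + r * w) in *. set (B := 0 + r * w') in *. set (A' := z + s * w) in *. set (B' := z + s * w') in *.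
assert (SA : S A) by (apply HA; auto). assert (SB : S B) by (apply HA; auto).
assert (SA' : S A') by (apply HB; auto). assert (SB' : S B') by (apply HB; auto).
pose proof (goursat S u A B B' HS Hcl Hd SA SB SB') as T1.
pose proof (goursat S u A B' A' HS Hcl Hd SA SB' SA') as T2.
unfold triangle_int in T1, T2.
rewrite (segint_swap S HS u A B' Hc SA SB') in T1.
rewrite (segint_swap S HS u A' B' Hc SA' SB'), (segint_swap S HS u A A' Hc SA SA') in T2.
transitivity (segint u A A' - segint u B B' + (segint u A B + segint u B B' + - segint u A B') +
  (segint u A B' + - segint u A' B' + - segint u A A')); [ring|].
rewrite T1, T2. ring.
Qed.

(** In the sum over the four trapezoids the connecting segments cancel. *)
Lemma diamond_int_shrink (u : C -> C) (z : C) (r s : R) :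
  (0 < s < r / 4)%R -> (Cmod z <= r / 2)%R ->
  (forall x, (Cmod x <= r)%R -> x <> z -> cdiff u x) ->
  diamond_int u 0 r = diamond_int u z s.
Proof.
intros Hs Hz Hu. destruct sides as [S1 [S2 [S3 S4]]].
pose proof (side_shrink u z _ _ _ r s S1 Hs Hz Hu) as H1.
pose proof (side_shrink u z _ _ _ r s S2 Hs Hz Hu) as H2.
pose proof (side_shrink u z _ _ _ r s S3 Hs Hz Hu) as H3.
pose proof (side_shrink u z _ _ _ r s S4 Hs Hz Hu) as H4.
unfold diamond_int.
match goal with |- ?x = ?y => replace x with (y + (x - y)) by ring; replace (x - y) with (RtoC 0); [ring|] end.
symmetry.
match type of H1 with ?a1 = ?b1 => match type of H2 with ?a2 = ?b2 => match type of H3 with ?a3 = ?b3 => match type of H4 with ?a4 = ?b4 =>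
 transitivity (a1 + a2 + a3 + a4); [ring|rewrite H1, H2, H3, H4; ring] end end end end.
Qed.

Lemma segint_change S u (p k a b : C) : convex S -> S a -> S b ->
  cont_on S (fun z => u (p + k * z)) ->
  segint u (p + k * a) (p + k * b) = segint (fun z => k * u (p + k * z)) a b.
Proof.
intros HS Ha Hb Hc. rewrite (segint_scal S HS (fun z => u (p + k * z))) by auto.
unfold segint. transitivity (RInt (V:=CV) (fun s : R => u (p + k * lerp a b s)) 0 1 * (k * (b - a))); [|ring].
f_equal; [|ring]. apply (RInt_ext (V:=CV)). intros x _. f_equal. ring.
Qed.

Lemma cap_side w w' k : is_side w w' k -> cap k 0 1 0 1 w /\ cap k 0 1 0 1 w'.
Proof.
intros [Hw [Hw' [Hk [Hkw [Hkw' _]]]]]. unfold cap.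
replace (w - 0) with w by ring. replace (w' - 0) with w' by ring. rewrite Hw, Hw', Hkw, Hkw'. lra.
Qed.

Lemma cap_lower k x : (Cmod k <= 3 / 2)%R -> cap k 0 1 0 1 x -> (2 / 3 <= Cmod x)%R.
Proof.
intros Hk [_ H]. replace (x - 0) with x in H by ring.
pose proof (Re_le_Cmod k x). pose proof (Rle_abs (Re (k * x)%C)). pose proof (Cmod_ge_0 x). nra.
Qed.

(** This constant equals [2 * PI * i]; the estimates below only use that its
    modulus is at least 4. *)
Definition winding : C := diamond_int Cinv 0 1.

Lemma segint_inv_rotate w w' k : is_side w w' k -> segint Cinv (0 + 1 * w) (0 + 1 * w') = segint Cinv 1 Ci.
Proof.
intros Hs. destruct sides as [S1 _].
assert (Hw0 : w <> 0) by (apply Cmod_gt_0; rewrite (proj1 Hs); lra).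
assert (Hw' : w' = Ci * w) by apply Hs.
destruct (cap_side _ _ _ S1) as [C1 C2].
set (S := cap (1, -1)%R 0 1 0 1) in *.
assert (HS : convex S) by apply convex_cap.
assert (Hn : forall x, S x -> x <> 0) by (intros x Hx; apply (cap_neq (1,-1)%R 0 1 0 1); [lra|exact Hx]).
replace (0 + 1 * w) with (0 + w * 1) by ring. replace (0 + 1 * w') with (0 + w * Ci) by (rewrite Hw'; ring).
rewrite (segint_change S Cinv 0 w 1 Ci HS C1 C2).
- apply (segint_ext S HS); auto. intros z Hz. field. auto.
- intros z Hz. apply cdiff_continuous. apply (cdiff_inv (fun z => 0 + w * z)).
  + apply (cdiff_plus (fun _ => 0) (fun z => w * z)); [apply cdiff_const|].
    apply (cdiff_mult (fun _ => w) (fun z => z)); [apply cdiff_const|apply cdiff_id].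
  + replace (0 + w * z) with (w * z) by ring. apply Cmult_neq_0; auto.
Qed.

(** By rotation the four sides contribute equally, and over the side from 1
    to [i] the integrand has imaginary part
    [1 / ((1 - s)^2 + s^2) >= 1]. *)
Lemma winding_lower : (4 <= Cmod winding)%R.
Proof.
destruct sides as [S1 [S2 [S3 S4]]].
assert (E : winding = RtoC 4 * segint Cinv 1 Ci).
{ unfold winding, diamond_int. rewrite (segint_inv_rotate _ _ _ S1), (segint_inv_rotate _ _ _ S2), (segint_inv_rotate _ _ _ S3), (segint_inv_rotate _ _ _ S4).
  ring. }
rewrite E, Cmod_mult, Cmod_R, Rabs_pos_eq by lra.
enough (H : (1 <= Cmod (segint Cinv 1 Ci))%R) by lra.
eapply Rle_trans; [|eapply Rle_trans; [apply Rmax_r|apply Rmax_Cmod]].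
eapply Rle_trans; [|apply Rle_abs].
destruct (cap_side _ _ _ S1) as [C1 C2].
set (S := cap (1, -1)%R 0 1 0 1) in *.
assert (HS : convex S) by apply convex_cap.
assert (Hc : cont_on S Cinv).
{ intros x Hx. apply cdiff_continuous, cdiff_inv_id, (cap_neq (1,-1)%R 0 1 0 1); [lra|exact Hx]. }
pose proof (RInt_correct (V:=CV) _ _ _ (ex_RInt_segment S HS Cinv 1 Ci Hc C1 C2)) as HI.
unfold segint. set (I := RInt (V:=CV) (fun s : R => / lerp 1 Ci s) 0 1) in *. clearbody I.
pose proof (is_RInt_fct_extend_fst (U:=R_NormedModule) (V:=R_NormedModule) _ _ _ _ HI) as H1.
pose proof (is_RInt_fct_extend_snd (U:=R_NormedModule) (V:=R_NormedModule) _ _ _ _ HI) as H2.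
pose proof (is_RInt_minus (V:=R_NormedModule) _ _ _ _ _ _ H1 H2) as H3.
replace (snd (I * (Ci - 1))) with (minus (fst I) (snd I)) by (unfold minus, plus, opp; simpl; ring).
replace 1%R with (scal (1 - 0) 1)%R by (unfold scal; simpl; unfold mult; simpl; ring).
eapply (is_RInt_le _ _ 0 1 _ _ Rle_0_1 (is_RInt_const (V:=R_NormedModule) 0 1 1%R) H3).
intros x Hx. unfold minus, plus, opp; simpl.
match goal with |- (1 <= ?a)%R => replace a with (/ ((1 - x) ^ 2 + x ^ 2))%R end.
- rewrite <- Rinv_1 at 1. apply Rinv_le_contravar; nra.
- field. nra.
Qed.

(** Shrink the contour to a square of size [s] around [z].  After rescaling, the
    integral over the small square is that of [h (z + s x) / x] over the unit
    square, and [h (z + s x)] tends to [h z] by continuity. *)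
Theorem cauchy_formula (h : C -> C) (z : C) (r : R) : (0 < r)%R ->
  (forall x, (Cmod x <= r)%R -> cdiff h x) -> (Cmod z <= r / 2)%R ->
  diamond_int (fun x => h x / (x - z)) 0 r = winding * h z.
Proof.
intros Hr Hh Hz. apply Cmod_eq_of_small. intros e He.
assert (Hhz : ccont h z) by (apply cdiff_continuous, Hh; lra).
destruct (proj1 (continuous_Cmod h z) Hhz (e / 12)%R) as [d [Hd Hcd]]; [lra|].
set (s := Rmin (d / 2) (r / 8)).
assert (Hs : (0 < s)%R) by (apply Rmin_pos; lra).
assert (Hs1 : (s <= d / 2)%R) by apply Rmin_l.
assert (Hs2 : (s <= r / 8)%R) by apply Rmin_r.
rewrite (diamond_int_shrink _ z r s); [|lra|exact Hz|].
2: { intros x Hx Hxz. apply (cdiff_div h (fun x => x - z)); [apply Hh, Hx| |].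
     - apply (cdiff_minus (fun x => x) (fun _ => z)); [apply cdiff_id|apply cdiff_const].
     - intros E. apply Hxz. replace x with (x - z + z) by ring. rewrite E. ring. }
assert (Hside : forall w w' k, is_side w w' k ->
  (Cmod (segint (fun x => (h x / (x - z))%C) (z + s * w) (z + s * w') - h z * segint Cinv (0 + 1 * w) (0 + 1 * w')) <= e / 4)%R).
{ intros w w' k HS. destruct (cap_side _ _ _ HS) as [C1 C2].
  set (S := cap k 0 1 0 1) in *.
  assert (HSc : convex S) by apply convex_cap.
  assert (Hn : forall x, S x -> x <> 0) by (intros x Hx; apply (cap_neq k 0 1 0 1); [lra|exact Hx]).
  assert (Hin : forall x, S x -> (Cmod (z + s * x - z) <= s)%R).
  { intros x [Hx _]. replace (x - 0) with x in Hx by ring. replace (z + s * x - z) with (s * x) by ring.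
    rewrite Cmod_mult, Cmod_R, Rabs_pos_eq by lra. nra. }
  assert (Hin' : forall x, S x -> (Cmod (z + s * x) <= r)%R).
  { intros x Hx. specialize (Hin x Hx). pose proof (Cmod_ge_sub (z + s * x) z) as H. lra. }
  assert (Hcs : forall x, S x -> cdiff (fun x => h (z + s * x)) x).
  { intros x Hx. apply (cdiff_comp h (fun x => z + s * x)); [apply Hh; auto|].
    apply (cdiff_plus (fun _ => z) (fun x => s * x)); [apply cdiff_const|].
    apply (cdiff_mult (fun _ => s) (fun x => x)); [apply cdiff_const|apply cdiff_id]. }
  assert (Hsn : RtoC s <> 0) by (intro E; injection E; lra).
  rewrite (segint_change S _ z s w w' HSc C1 C2).
  2:{ intros x Hx. apply cdiff_continuous.
      apply (cdiff_div (fun x => h (z + s * x)) (fun x => z + s * x - z)); [auto| |].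
      - apply (cdiff_minus (fun x => z + s * x) (fun _ => z)); [|apply cdiff_const].
        apply (cdiff_plus (fun _ => z) (fun x => s * x)); [apply cdiff_const|].
        apply (cdiff_mult (fun _ => s) (fun x => x)); [apply cdiff_const|apply cdiff_id].
      - replace (z + s * x - z) with (s * x) by ring. apply Cmult_neq_0; auto. }
  replace (0 + 1 * w) with w by ring. replace (0 + 1 * w') with w' by ring.
  assert (Hci : cont_on S Cinv) by (intros x Hx; apply cdiff_continuous, cdiff_inv_id; auto).
  assert (Hcq : cont_on S (fun x => h (z + s * x) * / x)).
  { intros x Hx. apply cdiff_continuous, (cdiff_mult (fun x => h (z + s * x)) Cinv); [auto|apply cdiff_inv_id; auto]. }
  assert (Hch : cont_on S (fun x => h z * / x)).
  { intros x Hx. apply cdiff_continuous, (cdiff_mult (fun x => h z) Cinv); [apply cdiff_const|apply cdiff_inv_id; auto]. }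
  rewrite (segint_ext S HSc _ (fun x => h (z + s * x) * / x)); auto.
  2:{ intros x Hx. field. split; auto. replace (z + s * x - z) with (s * x) by ring. apply Cmult_neq_0; auto. }
  rewrite <- (segint_scal S HSc Cinv) by auto.
  rewrite <- (segint_minus S HSc) by auto.
  assert (Hlen : (Cmod (w' - w) <= 2)%R).
  { eapply Rle_trans; [apply Cmod_sub_le|]. destruct HS as [E1 [E2 _]]. lra. }
  apply Rle_trans with (e / 8 * Cmod (w' - w))%R; [|pose proof (Cmod_ge_0 (w' - w)); nra].
  apply (segint_bound S HSc); auto.
  - intros x Hx. apply cdiff_continuous, (cdiff_minus (fun x => h (z + s * x) * / x) (fun x => h z * / x)).
    + apply (cdiff_mult (fun x => h (z + s * x)) Cinv); [auto|apply cdiff_inv_id; auto].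
    + apply (cdiff_mult (fun x => h z) Cinv); [apply cdiff_const|apply cdiff_inv_id; auto].
  - intros t Ht. set (x := lerp w w' t). assert (Hx : S x) by (apply HSc; auto).
    replace (h (z + s * x) * / x - h z * / x) with ((h (z + s * x) - h z) * / x) by ring.
    rewrite Cmod_mult, Cmod_inv by auto.
    pose proof (cap_lower k x (proj1 (proj2 (proj2 HS))) Hx) as Hxl.
    assert (Hh1 : (Cmod (h (z + s * x)%C - h z) < e / 12)%R) by (apply Hcd; specialize (Hin x Hx); lra).
    assert (Hi : (/ Cmod x <= 3 / 2)%R).
    { replace (3/2)%R with (/ (2/3))%R by field. apply Rinv_le_contravar; lra. }
    assert (0 < / Cmod x)%R by (apply Rinv_0_lt_compat; lra).
    pose proof (Cmod_ge_0 (h (z + s * x) - h z)). nra. }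
destruct sides as [S1 [S2 [S3 S4]]].
apply Hside in S1. apply Hside in S2. apply Hside in S3. apply Hside in S4.
unfold winding, diamond_int.
match type of S1 with (Cmod ?a1 <= _)%R => match type of S2 with (Cmod ?a2 <= _)%R => match type of S3 with (Cmod ?a3 <= _)%R => match type of S4 with (Cmod ?a4 <= _)%R =>
 match goal with |- (Cmod ?x <= _)%R => replace x with (a1 + a2 + a3 + a4) by ring end;
 pose proof (Cmod_triangle (a1 + a2 + a3) a4); pose proof (Cmod_triangle (a1 + a2) a3); pose proof (Cmod_triangle a1 a2)
 end end end end. lra.
Qed.

(** * Divided differences, Cauchy estimates and limits of holomorphic functions *)

(** For [n = 0] this is [h] itself, by Cauchy's formula, and in general it is the
    n-th divided difference of [h] at the points [0, ..., 0, z]. *)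
Definition divdiff (h : C -> C) (r : R) (k : nat) (z : C) : C :=
  / winding * diamond_int (fun x => h x / (x ^ k * (x - z))) 0 r.

Lemma cap_scaled_side w w' k (r : R) : (0 < r)%R -> is_side w w' k ->
  cap k 0 r 0 r (0 + r * w) /\ cap k 0 r 0 r (0 + r * w').
Proof.
intros Hr [Hw [Hw' [Hk [Hkw [Hkw' _]]]]]. unfold cap.
assert (H : forall w0 : C, Cmod w0 = 1%R -> Re (k * w0) = 1%R -> (Cmod (0 + r * w0 - 0) <= r)%R /\ (r <= Re (k * (0 + r * w0 - 0))%C)%R).
{ intros w0 H1 H2. split.
  - replace (0 + r * w0 - 0) with (r * w0) by ring. rewrite Cmod_mult, Cmod_R, H1, Rabs_pos_eq by lra. lra.
  - replace (k * (0 + r * w0 - 0)) with (r * (k * w0)) by ring.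
    unfold Re in *. simpl in *. nra. }
split; apply H; assumption.
Qed.

(** The two factors of the Cauchy kernel stay away from 0 on the contour, since
    the form [Re (k x)] is [r] there and at most [3 r / 4] at [z]. *)
Lemma cap_kernel_lower k (r : R) x z : (0 < r)%R -> (Cmod k <= 3 / 2)%R -> cap k 0 r 0 r x -> (Cmod z <= r / 2)%R ->
  (r / 2 <= Cmod x /\ r / 6 <= Cmod (x - z))%R.
Proof.
intros Hr Hk [_ H] Hz. replace (x - 0) with x in H by ring.
pose proof (Re_le_Cmod k x). pose proof (Rle_abs (Re (k * x)%C)). pose proof (Cmod_ge_0 x).
pose proof (Re_le_Cmod k (x - z)). pose proof (Rle_abs (Re (k * (x - z))%C)). pose proof (Cmod_ge_0 (x - z)).
pose proof (Re_le_Cmod k z). pose proof (Rle_abs (Re (k * z)%C)). pose proof (Cmod_ge_0 z).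
assert (E : Re (k * (x - z)) = (Re (k * x)%C - Re (k * z)%C)%R) by (unfold Re; simpl; ring).
pose proof (Cmod_ge_0 k). split; nra.
Qed.

Section DividedDifferences.
Variables (h : C -> C) (r M : R).
Hypothesis Hr : (0 < r)%R.
Hypothesis Hh : forall x, (Cmod x <= r)%R -> cdiff h x.
Hypothesis HM : forall x, (Cmod x <= r)%R -> (Cmod (h x) <= M)%R.

Lemma cauchy_kernel_cont k n z : (Cmod k <= 3 / 2)%R -> (Cmod z <= r / 2)%R ->
  cont_on (cap k 0 r 0 r) (fun x => h x / (x ^ n * (x - z))).
Proof.
intros Hk Hz x Hx. destruct (cap_kernel_lower k r x z Hr Hk Hx Hz) as [H1 H2].
apply cdiff_continuous, (cdiff_div h (fun x => x ^ n * (x - z))).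
- apply Hh. destruct Hx as [Hx _]. replace (x - 0) with x in Hx by ring. exact Hx.
- apply (cdiff_mult (fun x => x ^ n) (fun x => x - z)).
  + apply (cdiff_pow (fun x => x)), cdiff_id.
  + apply (cdiff_minus (fun x => x) (fun _ => z)); [apply cdiff_id|apply cdiff_const].
- apply Cmult_neq_0; [apply Cpow_nz|]; apply Cmod_pos_neq_0; lra.
Qed.

(** This is the identity
    [1 / (x^n (x - z)) = 1 / x^(n+1) + z / (x^(n+1) (x - z))]. *)
Lemma side_recursion w w' k n z : is_side w w' k -> (Cmod z <= r / 2)%R ->
  segint (fun x => h x / (x ^ n * (x - z))) (0 + r * w) (0 + r * w') =
  segint (fun x => h x / (x ^ n * (x - 0))) (0 + r * w) (0 + r * w') +
  z * segint (fun x => h x / (x ^ S n * (x - z))) (0 + r * w) (0 + r * w').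
Proof.
intros Hs Hz. destruct (cap_scaled_side _ _ _ r Hr Hs) as [C1 C2].
assert (Hk : (Cmod k <= 3 / 2)%R) by apply Hs.
assert (H0 : (Cmod 0 <= r / 2)%R) by (rewrite Cmod_0; lra).
set (D := cap k 0 r 0 r) in *. assert (HD : convex D) by apply convex_cap.
pose proof (cauchy_kernel_cont k n 0 Hk H0) as K0. pose proof (cauchy_kernel_cont k (S n) z Hk Hz) as K1.
rewrite <- (segint_scal D HD _ z) by auto.
assert (K2 : cont_on D (fun x => z * (h x / (x ^ S n * (x - z))))).
{ intros x Hx. apply (continuous_comp (U:=C_UniformSpace) (V:=C_UniformSpace) (W:=C_UniformSpace) _ (fun y => z * y)).
  apply K1, Hx. apply cdiff_continuous, (cdiff_mult (fun _ => z) (fun y => y)); [apply cdiff_const|apply cdiff_id]. }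
rewrite <- (segint_plus D HD) by auto.
apply (segint_ext D HD); auto. intros x Hx. destruct (cap_kernel_lower k r x z Hr Hk Hx Hz) as [H1 H2].
assert (N1 : x <> 0) by (apply Cmod_pos_neq_0; lra). assert (N2 : x - z <> 0) by (apply Cmod_pos_neq_0; lra).
simpl. field. repeat split; auto. replace (x - 0) with x by ring. auto. apply Cpow_nz; auto.
Qed.

Lemma side_bound w w' k n z : is_side w w' k -> (Cmod z <= r / 2)%R ->
  (Cmod (segint (fun x => h x / (x ^ n * (x - z)))%C (0 + r * w) (0 + r * w')) <= 12 * M * (2 / r) ^ n)%R.
Proof.
intros Hs Hz. destruct (cap_scaled_side _ _ _ r Hr Hs) as [C1 C2].
assert (Hk : (Cmod k <= 3 / 2)%R) by apply Hs.
set (D := cap k 0 r 0 r) in *. assert (HD : convex D) by apply convex_cap.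
assert (HM0 : (0 <= M)%R) by (eapply Rle_trans; [apply Cmod_ge_0|apply (HM 0); rewrite Cmod_0; lra]).
assert (Hp : (0 < (2 / r) ^ n)%R) by (apply pow_lt, Rdiv_lt_0_compat; lra).
eapply Rle_trans; [apply (segint_bound D HD _ _ _ (M * ((2 / r) ^ n * (6 / r)))%R (cauchy_kernel_cont k n z Hk Hz)); auto|].
- intros t Ht. set (x := lerp _ _ t). assert (Hx : D x) by (apply HD; auto).
  destruct (cap_kernel_lower k r x z Hr Hk Hx Hz) as [H1 H2].
  assert (N1 : x <> 0) by (apply Cmod_pos_neq_0; lra). assert (N2 : x - z <> 0) by (apply Cmod_pos_neq_0; lra).
  assert (N3 : x ^ n <> 0) by (apply Cpow_nz; auto).
  rewrite Cmod_div by (apply Cmult_neq_0; auto). unfold Rdiv at 1. apply Rmult_le_compat.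
  + apply Cmod_ge_0.
  + left. apply Rinv_0_lt_compat, Cmod_gt_0, Cmult_neq_0; auto.
  + apply HM. destruct Hx as [Hx _]. replace (x - 0) with x in Hx by ring. exact Hx.
  + rewrite Cmod_mult, Cmod_pow, Rinv_mult, <- pow_inv. apply Rmult_le_compat.
    * apply pow_le. left. apply Rinv_0_lt_compat; lra.
    * left. apply Rinv_0_lt_compat; lra.
    * apply pow_incr. split; [left; apply Rinv_0_lt_compat; lra|].
      replace (2 / r)%R with (/ (r / 2))%R by (field; lra). apply Rinv_le_contravar; lra.
    * replace (6 / r)%R with (/ (r / 6))%R by (field; lra). apply Rinv_le_contravar; lra.
- replace (0 + r * w' - (0 + r * w)) with (r * (w' - w)) by ring. rewrite Cmod_mult, Cmod_R, Rabs_pos_eq by lra.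
  assert (Hlen : (Cmod (w' - w) <= 2)%R).
  { eapply Rle_trans; [apply Cmod_sub_le|]. destruct Hs as [E1 [E2 _]]. lra. }
  replace (M * ((2 / r) ^ n * (6 / r)) * (r * Cmod (w' - w)))%R with (M * (2 / r) ^ n * 6 * Cmod (w' - w))%R by (field; lra).
  pose proof (Rmult_le_pos _ _ HM0 (Rlt_le _ _ Hp)). nra.
Qed.

Lemma winding_neq_0 : winding <> 0.
Proof. apply Cmod_pos_neq_0. pose proof winding_lower. lra. Qed.

Lemma divdiff_0 z : (Cmod z <= r / 2)%R -> divdiff h r 0 z = h z.
Proof.
intros Hz. unfold divdiff.
replace (diamond_int (fun x => h x / (x ^ 0 * (x - z))) 0 r) with (diamond_int (fun x => h x / (x - z)) 0 r).
- rewrite cauchy_formula by assumption. field. apply winding_neq_0.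
- assert (E : forall a b, segint (fun x => h x / (x - z)) a b = segint (fun x => h x / (x ^ 0 * (x - z))) a b).
  { intros a b. unfold segint. f_equal. apply (RInt_ext (V:=CV)). intros x _. simpl. rewrite Cmult_1_l. reflexivity. }
  unfold diamond_int. rewrite !E. reflexivity.
Qed.

Lemma divdiff_S n z : (Cmod z <= r / 2)%R -> divdiff h r n z = divdiff h r n 0 + z * divdiff h r (S n) z.
Proof.
intros Hz. unfold divdiff, diamond_int. destruct sides as [S1 [S2 [S3 S4]]].
rewrite (side_recursion _ _ _ n z S1 Hz), (side_recursion _ _ _ n z S2 Hz), (side_recursion _ _ _ n z S3 Hz), (side_recursion _ _ _ n z S4 Hz).
ring.
Qed.

Lemma divdiff_bound n z : (Cmod z <= r / 2)%R -> (Cmod (divdiff h r n z) <= 12 * M * (2 / r) ^ n)%R.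
Proof.
intros Hz. unfold divdiff. rewrite Cmod_mult, Cmod_inv by apply winding_neq_0.
pose proof winding_lower as HK.
assert (HD : (Cmod (diamond_int (fun x => h x / (x ^ n * (x - z)))%C 0 r) <= 4 * (12 * M * (2 / r) ^ n))%R).
{ unfold diamond_int. destruct sides as [S1 [S2 [S3 S4]]].
  pose proof (side_bound _ _ _ n z S1 Hz). pose proof (side_bound _ _ _ n z S2 Hz).
  pose proof (side_bound _ _ _ n z S3 Hz). pose proof (side_bound _ _ _ n z S4 Hz).
  eapply Rle_trans; [apply Cmod_triangle|].
  eapply Rle_trans; [apply Rplus_le_compat_r, Cmod_triangle|].
  eapply Rle_trans; [apply Rplus_le_compat_r, Rplus_le_compat_r, Cmod_triangle|]. lra. }
apply (Rmult_le_reg_l (Cmod winding)); [lra|].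
rewrite <- Rmult_assoc, Rinv_r, Rmult_1_l by lra.
pose proof (Cmod_ge_0 (diamond_int (fun x => h x / (x ^ n * (x - z)))%C 0 r)). nra.
Qed.
End DividedDifferences.

(** A Schwarz lemma of order [n], up to constants.  If the first [k] divided
    differences vanish at 0 then [h z = z^k * divdiff k z], and the order of
    vanishing of [h] makes the next one vanish at 0 too, as long as [k < n]. *)
Lemma schwarz_order (h : C -> C) (r M A d : R) (n : nat) : (0 < r)%R ->
  (forall x, (Cmod x <= r)%R -> cdiff h x /\ (Cmod (h x) <= M)%R) ->
  (0 < d)%R -> (forall x, (Cmod x < d)%R -> (Cmod (h x) <= A * Cmod x ^ n)%R) ->
  forall z, (Cmod z <= r / 2)%R -> (Cmod (h z) <= 12 * M * (2 / r * Cmod z) ^ n)%R.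
Proof.
intros Hr Hh Hd HA z Hz.
assert (Hh1 : forall x, (Cmod x <= r)%R -> cdiff h x) by apply Hh.
assert (HM : forall x, (Cmod x <= r)%R -> (Cmod (h x) <= M)%R) by apply Hh.
assert (HA0 : (0 <= A)%R).
{ set (x := RtoC (d / 2)). assert (Hx : Cmod x = (d / 2)%R) by (unfold x; rewrite Cmod_R, Rabs_pos_eq; lra).
  specialize (HA x ltac:(lra)). pose proof (Cmod_ge_0 (h x)). rewrite Hx in HA.
  pose proof (pow_lt (d / 2) n ltac:(lra)). nra. }
assert (HM0 : (0 <= M)%R) by (eapply Rle_trans; [apply Cmod_ge_0|apply (HM 0); rewrite Cmod_0; lra]).
assert (Hrep : forall k, (k <= n)%nat -> forall x, (Cmod x <= r / 2)%R -> h x = x ^ k * divdiff h r k x).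
{ induction k; intros Hk x Hx.
  - rewrite divdiff_0 by assumption. simpl. ring.
  - specialize (IHk ltac:(lia)).
    assert (H0 : divdiff h r k 0 = 0).
    { apply Cmod_eq_0, Rle_antisym; [|apply Cmod_ge_0].
      set (B := (12 * M * (2 / r) ^ S k)%R).
      assert (HB : (0 <= B)%R) by (apply Rmult_le_pos; [lra|apply pow_le; left; apply Rdiv_lt_0_compat; lra]).
      apply le_epsilon. intros e He. rewrite Rplus_0_l.
      (* At a small point [y], [divdiff k y] is [O(y)] because [h] is [O(y^n)], and it
         differs from [divdiff k 0] by [O(y)]. *)
      set (y := Rmin (Rmin (d / 2) 1) (Rmin (r / 2) (e / (A + B + 1)))).
      assert (He' : (0 < e / (A + B + 1))%R) by (apply Rdiv_lt_0_compat; lra).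
      assert (Hy : (0 < y)%R) by (repeat apply Rmin_pos; lra).
      assert (Hy1 : (y <= d / 2 /\ y <= 1)%R) by (split; (eapply Rle_trans; [apply Rmin_l|]); [apply Rmin_l|apply Rmin_r]).
      assert (Hy2 : (y <= r / 2 /\ y <= e / (A + B + 1))%R) by (split; (eapply Rle_trans; [apply Rmin_r|]); [apply Rmin_l|apply Rmin_r]).
      set (Y := RtoC y). assert (HY : Cmod Y = y) by (unfold Y; rewrite Cmod_R, Rabs_pos_eq; lra).
      pose proof (IHk Y ltac:(lra)) as E1. pose proof (divdiff_S h r Hr Hh1 k Y ltac:(lra)) as E2.
      pose proof (divdiff_bound h r M Hr Hh1 HM (S k) Y ltac:(lra)) as E3. fold B in E3.
      specialize (HA Y ltac:(lra)). rewrite E1, Cmod_mult, Cmod_pow, HY in HA.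
      assert (HT : (Cmod (divdiff h r k Y) <= A * y)%R).
      { replace n with (k + (n - k))%nat in HA by lia. rewrite pow_add in HA.
        pose proof (pow_lt y k Hy) as Hyk.
        apply (Rmult_le_reg_l (y ^ k)); [exact Hyk|].
        eapply Rle_trans; [exact HA|].
        replace (A * (y ^ k * y ^ (n - k)))%R with (y ^ k * (A * y ^ (n - k)))%R by ring.
        apply Rmult_le_compat_l; [lra|]. apply Rmult_le_compat_l; [lra|].
        replace (n - k)%nat with (S (n - k - 1)) by lia. simpl.
        assert (y ^ (n - k - 1) <= 1)%R by (rewrite <- (pow1 (n - k - 1)); apply pow_incr; lra). nra. }
      replace (divdiff h r k 0) with (divdiff h r k Y - Y * divdiff h r (S k) Y) by (rewrite E2 at 1; ring).
      eapply Rle_trans; [apply Cmod_sub_le|]. rewrite Cmod_mult, HY.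
      assert (Hf : (y * (A + B + 1) <= e)%R).
      { replace e with (e / (A + B + 1) * (A + B + 1))%R by (field; lra). apply Rmult_le_compat_r; lra. }
      nra. }
    rewrite (IHk x Hx), (divdiff_S h r Hr Hh1 k x Hx), H0. simpl. ring. }
rewrite (Hrep n (Nat.le_refl n) z Hz), Cmod_mult, Cmod_pow, Rpow_mult_distr.
pose proof (divdiff_bound h r M Hr Hh1 HM n z Hz).
pose proof (pow_le (Cmod z) n (Cmod_ge_0 z)). nra.
Qed.

(** The bounds for the first and second divided differences at [a]. *)
Lemma cauchy_expansion (h : C -> C) (a : C) (r M : R) : (0 < r)%R ->
  (forall x, (Cmod (x - a) <= r)%R -> cdiff h x /\ (Cmod (h x) <= M)%R) ->
  exists d : C, forall z, (Cmod (z - a) <= r / 2)%R ->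
   (Cmod (h z - h a) <= 24 * M / r * Cmod (z - a) /\
    Cmod (h z - h a - d * (z - a)) <= 48 * M / (r * r) * (Cmod (z - a) * Cmod (z - a)))%R.
Proof.
intros Hr Hh. set (g := fun x => h (a + x)).
assert (Hg1 : forall x, (Cmod x <= r)%R -> cdiff g x).
{ intros x Hx. apply (cdiff_comp h (fun x => a + x)).
  - apply Hh. replace (a + x - a) with x by ring. exact Hx.
  - apply (cdiff_plus (fun _ => a) (fun x => x)); [apply cdiff_const|apply cdiff_id]. }
assert (HgM : forall x, (Cmod x <= r)%R -> (Cmod (g x) <= M)%R).
{ intros x Hx. apply Hh. replace (a + x - a) with x by ring. exact Hx. }
exists (divdiff g r 1 0). intros z Hz. set (x := z - a) in *.
assert (H0 : (Cmod 0 <= r / 2)%R) by (rewrite Cmod_0; lra).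
assert (Ez : h z = divdiff g r 0 x).
{ rewrite divdiff_0 by assumption. unfold g, x. f_equal. ring. }
assert (Ea : h a = divdiff g r 0 0).
{ rewrite divdiff_0 by assumption. unfold g. f_equal. ring. }
rewrite Ez, Ea, (divdiff_S g r Hr Hg1 0 x Hz).
pose proof (divdiff_bound g r M Hr Hg1 HgM 1 x Hz) as B1.
pose proof (divdiff_bound g r M Hr Hg1 HgM 2 x Hz) as B2.
pose proof (Cmod_ge_0 x). split.
- replace (divdiff g r 0 0 + x * divdiff g r 1 x - divdiff g r 0 0) with (x * divdiff g r 1 x) by ring.
  rewrite Cmod_mult. replace (24 * M / r * Cmod x)%R with (Cmod x * (12 * M * (2 / r) ^ 1))%R by (field; lra).
  apply Rmult_le_compat_l; auto.
- rewrite (divdiff_S g r Hr Hg1 1 x Hz).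
  replace (divdiff g r 0 0 + x * (divdiff g r 1 0 + x * divdiff g r 2 x) - divdiff g r 0 0 - divdiff g r 1 0 * x)
    with (x * x * divdiff g r 2 x) by ring.
  rewrite !Cmod_mult. replace (48 * M / (r * r) * (Cmod x * Cmod x))%R with (Cmod x * Cmod x * (12 * M * (2 / r) ^ 2))%R by (field; lra).
  apply Rmult_le_compat_l; [nra|auto].
Qed.

(** The second-order expansions at [a] have a uniform remainder
    [B * |z - a|^2].  Comparing two of them at one point at distance [y] shows
    that the derivatives at [a] differ by at most [2 B y] plus terms that tend to
    0, so they form a Cauchy sequence.  The expansion then passes to the limit. *)
Lemma cdiff_limit (hn : nat -> C -> C) (h : C -> C) (a : C) (r M : R) : (0 < r)%R ->
  (forall n x, (Cmod (x - a) <= r)%R -> cdiff (hn n) x /\ (Cmod (hn n x) <= M)%R) ->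
  (forall x, (Cmod (x - a) <= r)%R -> converges (fun n => hn n x) (h x)) ->
  cdiff h a.
Proof.
intros Hr Hhn Hlim.
assert (Haa : (Cmod (a - a) <= r)%R) by (replace (a - a) with (RtoC 0) by ring; rewrite Cmod_0; lra).
destruct (functional_choice _ (fun n => cauchy_expansion (hn n) a r M Hr (Hhn n))) as [d Hd].
assert (HM0 : (0 <= M)%R) by (eapply Rle_trans; [apply Cmod_ge_0|apply (Hhn O a Haa)]).
set (B := (48 * M / (r * r))%R) in *.
assert (HB : (0 <= B)%R).
{ unfold B. apply Rmult_le_pos; [lra|]. left. apply Rinv_0_lt_compat. nra. }
destruct (C_cauchy_converges d) as [D HD].
{ intros e He.
  (* The comparison point: at this distance the quadratic remainders contribute at
     most [e / 2] to the difference of the derivatives. *)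
  set (y := Rmin (r / 2) (e / (4 * B + 4))).
  assert (He' : (0 < e / (4 * B + 4))%R) by (apply Rdiv_lt_0_compat; lra).
  assert (Hy : (0 < y)%R) by (apply Rmin_pos; lra).
  assert (Hy1 : (y <= r / 2)%R) by apply Rmin_l. assert (Hy2 : (y <= e / (4 * B + 4))%R) by apply Rmin_r.
  assert (Hye : (y * (4 * B + 4) <= e)%R).
  { replace e with (e / (4 * B + 4) * (4 * B + 4))%R by (field; lra). apply Rmult_le_compat_r; lra. }
  set (z := a + y). assert (Hz : Cmod (z - a) = y).
  { unfold z. replace (a + y - a) with (RtoC y) by ring. rewrite Cmod_R, Rabs_pos_eq; lra. }
  assert (Hey : (0 < e * y / 16)%R) by nra.
  destruct (Hlim z ltac:(lra) _ Hey) as [N1 HN1]. destruct (Hlim a Haa _ Hey) as [N2 HN2].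
  exists (Nat.max N1 N2). intros n m Hn Hm.
  pose proof (HN1 n ltac:(lia)) as A1. pose proof (HN1 m ltac:(lia)) as A2.
  pose proof (HN2 n ltac:(lia)) as A3. pose proof (HN2 m ltac:(lia)) as A4. cbv beta in *.
  destruct (Hd n z ltac:(lra)) as [_ D1]. destruct (Hd m z ltac:(lra)) as [_ D2]. rewrite Hz in D1, D2.
  assert (E : (d n - d m) * (z - a) =
    ((hn n z - h z) - (hn m z - h z)) - ((hn n a - h a) - (hn m a - h a))
     - ((hn n z - hn n a - d n * (z - a)) - (hn m z - hn m a - d m * (z - a)))) by ring.
  apply (f_equal Cmod) in E. rewrite Cmod_mult, Hz in E.
  match type of E with (_ = Cmod (?p - ?q - ?s))%R =>
    pose proof (Cmod_sub_le (p - q) s); pose proof (Cmod_sub_le p q) end.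
  pose proof (Cmod_sub_le (hn n z - h z) (hn m z - h z)).
  pose proof (Cmod_sub_le (hn n a - h a) (hn m a - h a)).
  pose proof (Cmod_sub_le (hn n z - hn n a - d n * (z - a)) (hn m z - hn m a - d m * (z - a))).
  apply (Rmult_lt_reg_r y); [exact Hy|].
  assert (B * (y * y) * 2 <= e * y / 2)%R by nra. nra. }
apply cdiff_iff. exists D. intros e He.
exists (Rmin (r / 2) (e / (B + 1))).
assert (He' : (0 < e / (B + 1))%R) by (apply Rdiv_lt_0_compat; lra).
split; [apply Rmin_pos; lra|].
intros z Hz.
assert (Hz1 : (Cmod (z - a) <= r / 2)%R) by (pose proof (Rmin_l (r / 2) (e / (B + 1))); lra).
assert (Hz2 : (Cmod (z - a) <= e / (B + 1))%R) by (pose proof (Rmin_r (r / 2) (e / (B + 1))); lra).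
assert (Hz3 : (Cmod (z - a) * (B + 1) <= e)%R).
{ replace e with (e / (B + 1) * (B + 1))%R by (field; lra). apply Rmult_le_compat_r; lra. }
pose proof (Cmod_ge_0 (z - a)) as Hp.
apply Rle_trans with (B * (Cmod (z - a) * Cmod (z - a)))%R; [|nra].
apply le_epsilon. intros e2 He2.
set (e3 := (e2 / (3 * (Cmod (z - a) + 1)))%R).
assert (He3 : (0 < e3)%R) by (apply Rdiv_lt_0_compat; lra).
assert (E3 : (3 * (Cmod (z - a) + 1) * e3 = e2)%R) by (unfold e3; field; lra).
destruct (Hlim z ltac:(lra) _ He3) as [N1 HN1]. destruct (Hlim a Haa _ He3) as [N2 HN2]. destruct (HD _ He3) as [N3 HN3].
set (n := Nat.max N1 (Nat.max N2 N3)).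
specialize (HN1 n ltac:(unfold n; lia)). specialize (HN2 n ltac:(unfold n; lia)). specialize (HN3 n ltac:(unfold n; lia)).
cbv beta in *. destruct (Hd n z ltac:(lra)) as [_ D1].
assert (E : h z - h a - D * (z - a) = (hn n z - hn n a - d n * (z - a)) - (hn n z - h z) + (hn n a - h a) + (d n - D) * (z - a)) by ring.
rewrite E.
eapply Rle_trans; [apply Cmod_triangle|]. eapply Rle_trans; [apply Rplus_le_compat_r, Cmod_triangle|].
eapply Rle_trans; [apply Rplus_le_compat_r, Rplus_le_compat_r, Cmod_sub_le|].
rewrite (Cmod_mult (d n - D)). nra.
Qed.

(** * Orbits of a perturbed translation of a half-plane *)

(** [G t] is a perturbation of the translation [w -> w - 1] on the half-plane
    [Re w >= R0], of size [A / (Re w)^2], and with a Lipschitz constant of the same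
    order in the point and in the parameter. *)
Section Dynamics.
Variables (G : C -> C -> C) (A R0 r : R).
Hypothesis HA : (0 < A)%R.
Hypothesis HR : (1 <= R0)%R.
Hypothesis Hr : (0 < r)%R.
Hypothesis G_near : forall (x : R) t w, (R0 <= x)%R -> (x <= Re w)%R -> (Cmod t <= r)%R ->
  (Cmod (G t w - (w - 1)) <= A / (x * x))%R.
Hypothesis G_lip : forall (x : R) t w w', (R0 <= x)%R -> (x <= Re w)%R -> (x <= Re w')%R -> (Cmod t <= r)%R ->
  (Cmod (G t w - G 0 w' - (w - w')) <= A * (Cmod (w - w') + Cmod t) / (x * x))%R.
Hypothesis G_diff : forall w, (R0 <= Re w)%R -> cdiff (G 0) w.

Fixpoint orbit (ts : nat -> C) (w : C) (k : nat) : C :=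
  match k with O => w | S k => G (ts k) (orbit ts w k) end.

(** To the right of this abscissa the accumulated perturbation is at most 1, and
    it changes distances by a factor between 1/2 and 3/2: the margin 3 makes the
    sums of the errors converge, and [4 * A] makes them small. *)
Definition abscissa : R := (R0 + 4 * A + 3)%R.

Lemma Re_near w c (d : R) : (Cmod (w - c) <= d)%R -> (Re c - d <= Re w)%R.
Proof.
intros H. pose proof (re_le_Cmod (w - c)) as H1. pose proof (Rle_abs (- Re (w - c))) as H2. rewrite Rabs_Ropp in H2.
unfold Re in *. simpl in *. lra.
Qed.

Lemma div_le_1 a y : (0 <= a <= y)%R -> (0 < y)%R -> (a / y <= 1)%R.
Proof. intros H Hy. apply (Rmult_le_reg_r y); [lra|]. unfold Rdiv. rewrite Rmult_assoc, Rinv_l; lra. Qed.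

(** Discrete form of the bound of a sum of [a / y^2] by [a / y]. *)
Lemma telescope a y : (0 <= a)%R -> (3 < y)%R -> (a / (y - 2) + a / ((y - 1) * (y - 1)) <= a / (y - 3))%R.
Proof.
intros Ha Hy.
assert (H : (a / (y - 3) - a / (y - 2) = a / ((y - 3) * (y - 2)))%R) by (field; lra).
assert (H2 : (a / ((y - 1) * (y - 1)) <= a / ((y - 3) * (y - 2)))%R).
{ apply Rmult_le_compat_l; [lra|]. apply Rinv_le_contravar; nra. }
lra.
Qed.

Lemma Re_plus_INR tau n : Re (tau + INR n) = (Re tau + INR n)%R.
Proof. unfold Re. simpl. ring. Qed.

(** The k-th point is within [A / (y - 2)] of the pure translate, where
    [y = x + n - k] bounds the real part of that translate from below.  This
    distance is at most 1, so the next error is at most [A / (y - 1)^2], and the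
    bound propagates by telescoping. *)
Lemma orbit_region ts (tau w : C) (x : R) (n : nat) : (forall k, (Cmod (ts k) <= r)%R) ->
  (abscissa <= x <= Re tau)%R -> (Cmod (w - (tau + INR n)) <= A / (x + INR n - 2))%R ->
  forall k, (k <= n)%nat ->
  (Cmod (orbit ts w k - (tau + INR (n - k))) <= A / (x + INR (n - k) - 2))%R /\
  (x + INR (n - k) - 1 <= Re (orbit ts w k))%R.
Proof.
intros Hts Hx Hw. unfold abscissa in Hx.
assert (HRe : forall k, (Cmod (orbit ts w k - (tau + INR (n - k))) <= A / (x + INR (n - k) - 2))%R ->
  (x + INR (n - k) - 1 <= Re (orbit ts w k))%R).
{ intros k Hk. apply Re_near in Hk. rewrite Re_plus_INR in Hk. pose proof (pos_INR (n - k)).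
  assert (A / (x + INR (n - k) - 2) <= 1)%R by (apply div_le_1; lra). lra. }
intros k. induction k; intros Hk.
- split; [|apply HRe]; rewrite Nat.sub_0_r; exact Hw.
- destruct (IHk ltac:(lia)) as [IH1 IH2].
  assert (Hc : (Cmod (orbit ts w (S k) - (tau + INR (n - S k))) <= A / (x + INR (n - S k) - 2))%R).
  { simpl. set (u := orbit ts w k) in *.
    replace (n - k)%nat with (S (n - S k)) in IH1, IH2 by lia. rewrite S_INR in IH1, IH2.
    set (y := (x + INR (n - S k) + 1)%R). pose proof (pos_INR (n - S k)).
    pose proof (G_near (y - 1) (ts k) u ltac:(unfold y; lra) ltac:(unfold y; lra) (Hts k)) as Hg.
    replace (G (ts k) u - (tau + INR (n - S k))) with ((u - (tau + (INR (n - S k) + 1)%R)) + (G (ts k) u - (u - 1)))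
      by (rewrite RtoC_plus; ring).
    eapply Rle_trans; [apply Cmod_triangle|].
    pose proof (telescope A y ltac:(lra) ltac:(unfold y; lra)) as Ht.
    replace (y - 3)%R with (x + INR (n - S k) - 2)%R in Ht by (unfold y; ring).
    replace (x + (INR (n - S k) + 1) - 2)%R with (y - 2)%R in IH1 by (unfold y; ring). lra. }
  split; [exact Hc|apply HRe, Hc].
Qed.

(** Two orbits, one with small parameters and one of [G 0], keep their initial
    difference up to a small fraction.  As long as the difference has not doubled,
    each step changes it by at most
    [2 A (|w - w'| + eta) / (y - 1)^2], and the sum of these changes telescopes. *)
Lemma orbit_compare ts (tau tau' w w' : C) (x eta : R) (n : nat) : (forall k, (Cmod (ts k) <= r)%R) ->
  (forall k, (Cmod (ts k) <= eta)%R) ->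
  (abscissa <= x <= Re tau)%R -> (x <= Re tau')%R ->
  (Cmod (w - (tau + INR n)) <= A / (x + INR n - 2))%R -> (Cmod (w' - (tau' + INR n)) <= A / (x + INR n - 2))%R ->
  (Cmod (orbit ts w n - orbit (fun _ => 0) w' n - (w - w')) <= 2 * A / (x - 2) * (Cmod (w - w') + eta))%R.
Proof.
intros Hts Heta Hx Hx' Hw Hw'.
assert (H0 : forall k : nat, (Cmod ((fun _ => 0) k) <= r)%R) by (intros k; rewrite Cmod_0; lra).
assert (He0 : (0 <= eta)%R) by (eapply Rle_trans; [apply Cmod_ge_0|apply (Heta O)]).
pose proof (orbit_region ts tau w x n Hts Hx Hw) as R1.
pose proof (orbit_region (fun _ => 0) tau' w' x n H0 ltac:(lra) Hw') as R2.
set (D := (Cmod (w - w') + eta)%R).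
assert (HD : (0 <= D)%R) by (unfold D; pose proof (Cmod_ge_0 (w - w')); lra).
unfold abscissa in Hx.
assert (H : forall k, (k <= n)%nat ->
  (Cmod (orbit ts w k - orbit (fun _ => 0) w' k - (w - w')) <= (2 * A * D) / (x + INR (n - k) - 2))%R).
{ induction k; intros Hk.
  - simpl. replace (w - w' - (w - w')) with (RtoC 0) by ring. rewrite Cmod_0.
    pose proof (pos_INR (n - 0)). apply Rmult_le_pos; [nra|]. left; apply Rinv_0_lt_compat; lra.
  - specialize (IHk ltac:(lia)). destruct (R1 k ltac:(lia)) as [_ Q1]. destruct (R2 k ltac:(lia)) as [_ Q2].
    simpl. set (u := orbit ts w k) in *. set (v := orbit (fun _ => 0) w' k) in *.
    replace (n - k)%nat with (S (n - S k)) in IHk, Q1, Q2 by lia. rewrite S_INR in IHk, Q1, Q2.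
    set (y := (x + INR (n - S k) + 1)%R). pose proof (pos_INR (n - S k)).
    replace (x + (INR (n - S k) + 1) - 2)%R with (y - 2)%R in IHk by (unfold y; ring).
    pose proof (G_lip (y - 1) (ts k) u v ltac:(unfold y; lra) ltac:(unfold y; lra) ltac:(unfold y; lra) (Hts k)) as Hg.
    assert (Huv : (Cmod (u - v) <= Cmod (w - w') + D)%R).
    { replace (u - v) with ((w - w') + (u - v - (w - w'))) by ring.
      eapply Rle_trans; [apply Cmod_triangle|]. apply Rplus_le_compat_l. eapply Rle_trans; [exact IHk|].
      replace (2 * A * D / (y - 2))%R with (D * (2 * A / (y - 2)))%R by (field; unfold y; lra).
      rewrite <- (Rmult_1_r D) at 2. apply Rmult_le_compat_l; [lra|]. apply div_le_1; unfold y; lra. }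
    assert (Hg' : (Cmod (G (ts k) u - G 0 v - (u - v)) <= (2 * A * D) / ((y - 1) * (y - 1)))%R).
    { eapply Rle_trans; [exact Hg|]. apply Rmult_le_compat_r.
      - left; apply Rinv_0_lt_compat. unfold y; nra.
      - specialize (Heta k). unfold D in *. nra. }
    replace (G (ts k) u - G 0 v - (w - w')) with ((u - v - (w - w')) + (G (ts k) u - G 0 v - (u - v))) by ring.
    eapply Rle_trans; [apply Cmod_triangle|].
    pose proof (telescope (2 * A * D) y ltac:(nra) ltac:(unfold y; lra)) as Ht.
    replace (y - 3)%R with (x + INR (n - S k) - 2)%R in Ht by (unfold y; ring). lra. }
specialize (H n (Nat.le_refl n)). rewrite Nat.sub_diag in H. simpl (INR 0) in H.
replace (2 * A / (x - 2) * D)%R with (2 * A * D / (x + 0 - 2))%R by (field; lra). exact H.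
Qed.

Definition psi_approx (n : nat) (tau : C) : C := orbit (fun _ => 0) (tau + INR n) n.

Lemma orbit_0_iter w k : orbit (fun _ => 0) w k = Nat.iter k (G 0) w.
Proof. induction k; simpl; congruence. Qed.

Lemma start_exact tau n (x : R) : (abscissa <= x)%R -> (Cmod (tau + INR n - (tau + INR n)) <= A / (x + INR n - 2))%R.
Proof.
intros Hx. unfold abscissa in Hx. replace (tau + INR n - (tau + INR n)) with (RtoC 0) by ring. rewrite Cmod_0.
pose proof (pos_INR n). left. apply Rdiv_lt_0_compat; lra.
Qed.

Lemma psi_approx_near n tau : (abscissa <= Re tau)%R -> (Cmod (psi_approx n tau - tau) <= A / (Re tau - 2))%R.
Proof.
intros Hx. unfold psi_approx.
assert (H0 : forall k : nat, (Cmod ((fun _ => 0) k) <= r)%R) by (intros k; rewrite Cmod_0; lra).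
destruct (orbit_region (fun _ => 0) tau (tau + INR n) (Re tau) n H0 ltac:(lra) (start_exact _ _ _ Hx) n (Nat.le_refl n)) as [H _].
rewrite Nat.sub_diag in H. simpl (INR 0) in H. rewrite Rplus_0_r, Cplus_0_r in H. exact H.
Qed.

(** The longer orbit passes near [tau + n] when n steps are left, and from there
    it is compared with the shorter one. *)
Lemma psi_approx_cauchy n m tau : (abscissa <= Re tau)%R -> (n <= m)%nat ->
  (Cmod (psi_approx m tau - psi_approx n tau) <= 2 * A / (Re tau + INR n - 2))%R.
Proof.
intros Hx Hnm.
assert (H0 : forall k : nat, (Cmod ((fun _ => 0) k) <= r)%R) by (intros k; rewrite Cmod_0; lra).
destruct (orbit_region (fun _ => 0) tau (tau + INR m) (Re tau) m H0 ltac:(lra) (start_exact _ _ _ Hx) (m - n)%nat ltac:(lia)) as [H _].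
replace (m - (m - n))%nat with n in H by lia.
set (u := orbit (fun _ => 0) (tau + INR m) (m - n)) in *.
assert (E : psi_approx m tau = orbit (fun _ => 0) u n).
{ unfold psi_approx, u. rewrite !orbit_0_iter, <- Nat.iter_add. f_equal. lia. }
pose proof (orbit_compare (fun _ => 0) tau tau u (tau + INR n) (Re tau) 0 n H0) as Hc.
specialize (Hc ltac:(intros k; cbv beta; rewrite Cmod_0; lra) ltac:(lra) ltac:(lra) H (start_exact _ _ _ Hx)).
rewrite E. unfold psi_approx at 1. set (p := orbit (fun _ => 0) u n) in *. set (q := orbit (fun _ => 0) (tau + INR n) n) in *.
replace (p - q) with ((u - (tau + INR n)) + (p - q - (u - (tau + INR n)))) by ring.
eapply Rle_trans; [apply Cmod_triangle|]. unfold abscissa in Hx.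
assert (2 * A / (Re tau - 2) <= 1)%R by (apply div_le_1; lra).
pose proof (Cmod_ge_0 (u - (tau + INR n))).
replace (2 * A / (Re tau + INR n - 2))%R with (2 * (A / (Re tau + INR n - 2)))%R by (pose proof (pos_INR n); field; lra).
nra.
Qed.

Lemma INR_unbounded_div (c y e : R) : (0 < e)%R -> (0 <= c)%R -> (0 < y)%R -> exists N, forall n, (N <= n)%nat -> (c / (y + INR n) < e)%R.
Proof.
intros He Hc Hy. destruct (INR_archimed e c He) as [N HN]. exists N. intros n Hn.
apply le_INR in Hn. pose proof (pos_INR N).
apply (Rmult_lt_reg_r (y + INR n)); [lra|]. unfold Rdiv. rewrite Rmult_assoc, Rinv_l by lra. nra.
Qed.

Lemma psi_approx_converges tau : (abscissa <= Re tau)%R -> exists p, converges (fun n => psi_approx n tau) p.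
Proof.
intros Hx. destruct (C_cauchy_lim (fun n => psi_approx n tau) (fun n => 2 * A / (Re tau + INR n - 2))%R) as [p [Hp _]].
- intros n m Hnm. apply psi_approx_cauchy; assumption.
- intros d Hd. unfold abscissa in Hx. destruct (INR_unbounded_div (2 * A) (Re tau - 2) d Hd ltac:(lra) ltac:(lra)) as [N HN].
  exists N. specialize (HN N (Nat.le_refl N)). replace (Re tau + INR N - 2)%R with (Re tau - 2 + INR N)%R by ring. exact HN.
- exists p. exact Hp.
Qed.

Section Limit.
Variable psi : C -> C.
Hypothesis psi_lim : forall tau, (abscissa <= Re tau)%R -> converges (fun n => psi_approx n tau) (psi tau).

Lemma psi_near tau : (abscissa <= Re tau)%R -> (Cmod (psi tau - tau) <= A / (Re tau - 2))%R.
Proof.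
intros Hx. apply (converges_le _ _ tau _ O (psi_lim tau Hx)). intros n _. apply psi_approx_near, Hx.
Qed.

Lemma psi_near_1 tau : (abscissa <= Re tau)%R -> (Cmod (psi tau - tau) <= 1)%R.
Proof.
intros Hx. eapply Rle_trans; [apply psi_near, Hx|]. unfold abscissa in Hx. apply div_le_1; lra.
Qed.

Lemma psi_Re tau : (abscissa <= Re tau)%R -> (Re tau - 1 <= Re (psi tau))%R.
Proof. intros Hx. apply Re_near, psi_near_1, Hx. Qed.

(** Both orbits start at [tau + n], so the parameters are the only source of
    their difference, and [orbit_compare] bounds it by the size of the
    parameters. *)
Lemma psi_nonautonomous (ts : nat -> nat -> C) tau : (abscissa <= Re tau)%R ->
  (forall n k, (Cmod (ts n k) <= r)%R) -> (forall n k, (Cmod (ts n k) <= 1 / (1 + INR n))%R) ->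
  converges (fun n => orbit (ts n) (tau + INR n) n) (psi tau).
Proof.
intros Hx Hr' Hs e He.
destruct (psi_lim tau Hx (e / 2)%R) as [N1 HN1]; [lra|].
destruct (INR_unbounded_div 1 1 (e / 2)) as [N2 HN2]; try lra.
exists (Nat.max N1 N2). intros n Hn. specialize (HN1 n ltac:(lia)). specialize (HN2 n ltac:(lia)). cbv beta in *.
pose proof (orbit_compare (ts n) tau tau (tau + INR n) (tau + INR n) (Re tau) _ n (Hr' n) (Hs n)
  ltac:(lra) ltac:(lra) (start_exact _ _ _ Hx) (start_exact _ _ _ Hx)) as Hc.
replace (tau + INR n - (tau + INR n)) with (RtoC 0) in Hc by ring. rewrite Cmod_0, Rplus_0_l in Hc.
set (p := orbit (ts n) (tau + INR n) n) in *. fold (psi_approx n tau) in Hc.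
replace (p - psi_approx n tau - 0) with (p - psi_approx n tau) in Hc by ring.
pose proof (Cmod_sub_triangle p (psi_approx n tau) (psi tau)).
unfold abscissa in Hx. assert (2 * A / (Re tau - 2) <= 1)%R by (apply div_le_1; lra).
assert (0 <= 1 / (1 + INR n))%R. { pose proof (pos_INR n). left. apply Rdiv_lt_0_compat; lra. }
nra.
Qed.

Lemma converges_unique (a : nat -> C) p q : converges a p -> converges a q -> p = q.
Proof.
intros Hp Hq. apply Cmod_eq_of_small. intros e He. destruct (Hq e He) as [N HN].
apply (converges_le a p q e N Hp). intros n Hn. left. apply HN, Hn.
Qed.

(** At finite level this is an identity: [n + 1] steps from
    [tau - 1 + (n + 1)] are [n] steps from [tau + n] followed by one more. *)
Lemma psi_equation tau : (abscissa + 1 <= Re tau)%R -> psi (tau - 1) = G 0 (psi tau).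
Proof.
intros Hx. assert (Hx1 : (abscissa <= Re (tau - 1))%R) by (unfold Re in *; simpl; lra).
assert (Hx2 : (abscissa <= Re tau)%R) by lra.
apply (converges_unique (fun n => psi_approx (S n) (tau - 1))).
- intros e He. destruct (psi_lim _ Hx1 e He) as [N HN]. exists N. intros n Hn. apply HN. lia.
- intros e He. destruct (psi_lim _ Hx2 (e / (1 + A))%R) as [N HN]; [apply Rdiv_lt_0_compat; lra|].
  exists N. intros n Hn. specialize (HN n Hn). cbv beta in HN.
  replace (psi_approx (S n) (tau - 1)) with (G 0 (psi_approx n tau)).
  2:{ unfold psi_approx. replace (tau - 1 + INR (S n)) with (tau + INR n) by (rewrite S_INR, RtoC_plus; ring). reflexivity. }
  pose proof (Re_near _ _ _ (psi_approx_near n tau Hx2)) as Q1. pose proof (psi_Re tau Hx2) as Q2.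
  assert (A / (Re tau - 2) <= 1)%R by (unfold abscissa in *; apply div_le_1; lra).
  set (p := psi_approx n tau) in *. set (q := psi tau) in *.
  pose proof (G_lip R0 0 p q ltac:(lra) ltac:(unfold abscissa in *; lra) ltac:(unfold abscissa in *; lra) ltac:(rewrite Cmod_0; lra)) as Hl.
  rewrite Cmod_0, Rplus_0_r in Hl.
  replace (G 0 p - G 0 q) with ((p - q) + (G 0 p - G 0 q - (p - q))) by ring.
  eapply Rle_lt_trans; [apply Cmod_triangle|].
  pose proof (Cmod_ge_0 (p - q)) as Hpq.
  assert (Hl' : (A * Cmod (p - q) / (R0 * R0) <= A * Cmod (p - q))%R).
  { apply (Rmult_le_reg_r (R0 * R0)); [nra|]. unfold Rdiv. rewrite Rmult_assoc, Rinv_l, Rmult_1_r by nra.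
    assert (0 <= A * Cmod (p - q))%R by nra. assert (1 <= R0 * R0)%R by nra. nra. }
  assert (He' : (Cmod (p - q) * (1 + A) < e)%R).
  { replace e with (e / (1 + A) * (1 + A))%R by (field; lra). apply Rmult_lt_compat_r; lra. }
  lra.
Qed.

(** Each [psi_approx n] is the identity plus a map with Lipschitz constant at most
    1/2. *)
Lemma psi_expanding tau tau' : (abscissa <= Re tau)%R -> (abscissa <= Re tau')%R ->
  (Cmod (tau - tau') <= 2 * Cmod (psi tau - psi tau'))%R.
Proof.
intros Hx Hx'.
assert (H0 : forall k : nat, (Cmod ((fun _ => 0) k) <= r)%R) by (intros k; rewrite Cmod_0; lra).
assert (Hn : forall n, (Cmod (psi_approx n tau - psi_approx n tau' - (tau - tau')) <= / 2 * Cmod (tau - tau'))%R).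
{ intros n.
  pose proof (orbit_compare (fun _ => 0) tau tau' (tau + INR n) (tau' + INR n) abscissa 0 n H0
    ltac:(intros k; cbv beta; rewrite Cmod_0; lra) ltac:(lra) ltac:(lra) (start_exact _ _ abscissa (Rle_refl _)) (start_exact _ _ abscissa (Rle_refl _))) as Hc.
  replace (tau + INR n - (tau' + INR n)) with (tau - tau') in Hc by ring. rewrite Rplus_0_r in Hc.
  eapply Rle_trans; [exact Hc|]. apply Rmult_le_compat_r; [apply Cmod_ge_0|].
  unfold abscissa. apply (Rmult_le_reg_r (R0 + 4 * A + 3 - 2)); [lra|]. unfold Rdiv. rewrite Rmult_assoc, Rinv_l; lra. }
apply le_epsilon. intros e He.
destruct (psi_lim _ Hx (e / 4)%R) as [N1 HN1]; [lra|]. destruct (psi_lim _ Hx' (e / 4)%R) as [N2 HN2]; [lra|].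
set (n := Nat.max N1 N2). specialize (HN1 n ltac:(unfold n; lia)). specialize (HN2 n ltac:(unfold n; lia)). specialize (Hn n).
cbv beta in *.
pose proof (Cmod_sub_le (psi_approx n tau - psi tau) (psi_approx n tau' - psi tau')).
pose proof (Cmod_triangle (psi_approx n tau - psi_approx n tau') (- (psi_approx n tau - psi_approx n tau' - (tau - tau')))) as Q2.
rewrite Cmod_opp in Q2.
replace (psi_approx n tau - psi_approx n tau' + - (psi_approx n tau - psi_approx n tau' - (tau - tau'))) with (tau - tau') in Q2 by ring.
pose proof (Cmod_triangle (psi tau - psi tau') ((psi_approx n tau - psi tau) - (psi_approx n tau' - psi tau'))) as Q3.
replace (psi tau - psi tau' + (psi_approx n tau - psi tau - (psi_approx n tau' - psi tau'))) with (psi_approx n tau - psi_approx n tau') in Q3 by ring.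
lra.
Qed.

Lemma psi_diff tau : (abscissa + 1 <= Re tau)%R -> cdiff psi tau.
Proof.
intros Hx.
assert (H0 : forall k : nat, (Cmod ((fun _ => 0) k) <= r)%R) by (intros k; rewrite Cmod_0; lra).
assert (Hre : forall x, (Cmod (x - tau) <= 1)%R -> (abscissa <= Re x)%R).
{ intros x Hxt. apply Re_near in Hxt. lra. }
apply (cdiff_limit psi_approx psi tau 1 (Cmod tau + 2)); [lra| |].
- intros n x Hxt. specialize (Hre x Hxt). split.
  + unfold psi_approx. pose proof (orbit_region (fun _ => 0) x (x + INR n) (Re x) n H0 ltac:(lra) (start_exact _ _ _ Hre)) as Hreg.
    assert (H : forall k, (k <= n)%nat -> cdiff (fun x => orbit (fun _ => 0) (x + INR n) k) x).
    { induction k; intros Hk; simpl.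
      - apply (cdiff_plus (fun x => x) (fun _ => INR n)); [apply cdiff_id|apply cdiff_const].
      - apply (cdiff_comp (G 0) (fun x => orbit (fun _ => 0) (x + INR n) k)); [|apply IHk; lia].
        apply G_diff. destruct (Hreg k ltac:(lia)) as [_ Q]. pose proof (pos_INR (n - k)). unfold abscissa in *. lra. }
    apply H. lia.
  + pose proof (psi_approx_near n x Hre) as Hn. assert (A / (Re x - 2) <= 1)%R by (unfold abscissa in *; apply div_le_1; lra).
    pose proof (Cmod_triangle (psi_approx n x - x) ((x - tau) + tau)) as Q.
    replace (psi_approx n x - x + (x - tau + tau)) with (psi_approx n x) in Q by ring.
    pose proof (Cmod_triangle (x - tau) tau). lra.
- intros x Hxt. apply psi_lim, Hre, Hxt.
Qed.
End Limit.
End Dynamics.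

(** * Inverting a map close to the identity *)

(** Iterate the contraction [z -> w - (h z - z)] from 0; its iterates have modulus
    at most [2 |w|]. *)
Lemma fixed_point_near_identity (h : C -> C) (rho : R) (w : C) : (0 < rho)%R -> h 0 = 0 ->
  (forall x y, (Cmod x <= rho)%R -> (Cmod y <= rho)%R -> (Cmod (h x - h y - (x - y)) <= / 2 * Cmod (x - y))%R) ->
  (Cmod w < rho / 2)%R -> exists z, (Cmod z < rho)%R /\ h z = w.
Proof.
intros Hrho H0 Hc Hw.
set (step := fun z => w - (h z - z)).
set (zn := fun n => Nat.iter n step 0).
assert (Hzs : forall k, zn (S k) = step (zn k)) by reflexivity.
assert (Hz0 : zn O = 0) by reflexivity. clearbody zn.
assert (Hz : forall n, (Cmod (zn n) <= 2 * Cmod w)%R).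
{ induction n.
  - rewrite Hz0, Cmod_0. pose proof (Cmod_ge_0 w). lra.
  - rewrite Hzs. unfold step. eapply Rle_trans; [apply Cmod_sub_le|].
    pose proof (Hc (zn n) 0 ltac:(lra) ltac:(rewrite Cmod_0; lra)) as H. rewrite H0 in H.
    replace (h (zn n) - 0 - (zn n - 0)) with (h (zn n) - zn n) in H by ring.
    replace (zn n - 0) with (zn n) in H by ring. lra. }
assert (Hstep : forall x y, (Cmod x <= rho)%R -> (Cmod y <= rho)%R -> (Cmod (step x - step y) <= / 2 * Cmod (x - y))%R).
{ intros x y Hx Hy. unfold step. replace (w - (h x - x) - (w - (h y - y))) with (- (h x - h y - (x - y))) by ring.
  rewrite Cmod_opp. auto. }
assert (Hd : forall n, (Cmod (zn (S n) - zn n) <= Cmod w * (1/2) ^ n)%R).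
{ induction n.
  - rewrite Hzs, Hz0. unfold step. rewrite H0. replace (w - (0 - 0) - 0) with w by ring. simpl. lra.
  - assert (HzS : forall k, (Cmod (zn k) <= rho)%R) by (intros k; specialize (Hz k); lra).
    pose proof (Hstep (zn (S n)) (zn n) (HzS _) (HzS _)) as Hs. rewrite <- (Hzs n), <- (Hzs (S n)) in Hs.
    change ((1/2) ^ S n)%R with (1/2 * (1/2) ^ n)%R. lra. }
destruct (C_cauchy_lim zn (fun n => 2 * Cmod w * (1/2) ^ n)%R) as [z [Hlim Hzn]].
{ intros n m Hnm. assert (H : (Cmod (zn m - zn n) <= 2 * Cmod w * (1/2) ^ n - 2 * Cmod w * (1/2) ^ m)%R).
  { induction Hnm.
    - replace (zn n - zn n) with (RtoC 0) by ring. rewrite Cmod_0. lra.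
    - pose proof (Hd m). pose proof (Cmod_sub_triangle (zn (S m)) (zn m) (zn n)).
      change ((1/2) ^ S m)%R with (1/2 * (1/2) ^ m)%R. lra. }
  pose proof (pow_lt (1/2) m ltac:(lra)). pose proof (Cmod_ge_0 w). nra. }
{ intros d Hd0. apply pow_half_small, Hd0. }
assert (Hzr : (Cmod z <= 2 * Cmod w)%R).
{ replace z with (z - 0) by ring. apply (converges_le zn z 0 _ O Hlim). intros n _.
  replace (zn n - 0) with (zn n) by ring. apply Hz. }
exists z. split; [lra|].
apply Cmod_eq_of_small. intros e He. destruct (Hlim (e / 4)%R) as [N HN]; [lra|].
pose proof (HN N ltac:(lia)) as A1. pose proof (HN (S N) ltac:(lia)) as A2.
pose proof (Hstep z (zn N) ltac:(lra) ltac:(pose proof (Hz N); lra)) as A3.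
rewrite <- (Hzs N) in A3.
replace (h z - w) with ((z - zn (S N)) - (step z - zn (S N))) by (unfold step; ring).
eapply Rle_trans; [apply Cmod_sub_le|]. rewrite (Cmod_sub_sym z (zn (S N))). rewrite (Cmod_sub_sym z (zn N)) in A3. lra.
Qed.

Lemma open_Cmod (P : C -> Prop) : (forall z, P z -> exists d : R, (0 < d)%R /\ forall y, (Cmod (y - z) < d)%R -> P y) ->
  open (T := C_UniformSpace) P.
Proof. intros H z Hz. apply locally_Cmod. auto. Qed.

(** Injectivity on the disc comes from the same inequality as surjectivity. *)
Lemma local_inverse_exists (D : C -> Prop) (h : C -> C) (rho : R) : (0 < rho)%R -> h 0 = 0 ->
  (forall x, (Cmod x <= rho)%R -> D x) ->
  (forall x y, (Cmod x <= rho)%R -> (Cmod y <= rho)%R -> (Cmod (h x - h y - (x - y)) <= / 2 * Cmod (x - y))%R) ->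
  exists (N W : C -> Prop) (g : C -> C), local_inverse D h N W g.
Proof.
intros Hrho H0 HD Hc.
assert (Hg : forall w, exists z, (Cmod w < rho / 2)%R -> (Cmod z < rho)%R /\ h z = w).
{ intros w. destruct (Rlt_dec (Cmod w) (rho / 2)) as [Hw|Hw].
  - destruct (fixed_point_near_identity h rho w Hrho H0 Hc Hw) as [z Hz]. exists z. auto.
  - exists 0. intros H. contradiction. }
destruct (functional_choice _ Hg) as [g Hg'].
exists (fun z => (Cmod z < rho)%R /\ (Cmod (h z) < rho / 2)%R), (fun w => (Cmod w < rho / 2)%R), g.
assert (Hinj : forall x y, (Cmod x <= rho)%R -> (Cmod y <= rho)%R -> h x = h y -> x = y).
{ intros x y Hx Hy E. specialize (Hc x y Hx Hy). rewrite E in Hc.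
  replace (h y - h y - (x - y)) with (- (x - y)) in Hc by ring. rewrite Cmod_opp in Hc.
  assert (Hxy : Cmod (x - y) = 0%R) by (pose proof (Cmod_ge_0 (x - y)); lra).
  apply Cmod_eq_0 in Hxy. replace x with (x - y + y) by ring. rewrite Hxy. ring. }
repeat split.
- apply open_Cmod. intros z [Hz1 Hz2].
  exists (Rmin (rho - Cmod z) ((rho / 2 - Cmod (h z)) / 2)). split; [apply Rmin_pos; lra|].
  intros y Hy.
  assert (Y1 : (Cmod (y - z) < rho - Cmod z)%R) by (eapply Rlt_le_trans; [exact Hy|apply Rmin_l]).
  assert (Y2 : (Cmod (y - z) < (rho / 2 - Cmod (h z)) / 2)%R) by (eapply Rlt_le_trans; [exact Hy|apply Rmin_r]).
  pose proof (Cmod_ge_sub y z) as Hyz. split; [lra|].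
  specialize (Hc y z ltac:(lra) ltac:(lra)).
  pose proof (Cmod_triangle (h y - h z - (y - z)) (y - z)) as T. replace (h y - h z - (y - z) + (y - z)) with (h y - h z) in T by ring.
  pose proof (Cmod_ge_sub (h y) (h z)). lra.
- rewrite Cmod_0. exact Hrho.
- rewrite H0, Cmod_0. lra.
- apply open_Cmod. intros z Hz. exists (rho / 2 - Cmod z)%R. split; [lra|]. intros y Hy.
  pose proof (Cmod_ge_sub y z). lra.
- rewrite Cmod_0. lra.
- apply HD. destruct H; lra.
- apply H.
- destruct H as [Hz Hhz]. destruct (Hg' (h z) Hhz). apply Hinj; lra || auto.
- apply Hg', H.
- destruct (Hg' w H) as [_ ->]. exact H.
- apply Hg', H.
Qed.

(** * The fibre maps near infinity *)

Lemma locally_C2 (t z : C) (P : C2 -> Prop) : locally (T:=C2) (t, z) P ->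
  exists e : R, (0 < e)%R /\ forall t' z' : C, (Cmod (t' - t) < e)%R -> (Cmod (z' - z) < e)%R -> P (t', z').
Proof.
intros [e He]. exists e. split; [apply cond_pos|]. intros t' z' Ht Hz. apply He.
split; apply C_NormedModule_mixin_compat1; assumption.
Qed.

(** The restriction of a map that is Frechet differentiable over C to a complex
    line, composed with a coordinate. *)
Lemma cdiff_directional (G : C2 -> C2) (t z a b s0 : C) : (Cmod a <= 1)%R -> (Cmod b <= 1)%R ->
  ex_filterdiff (U:=C2) (V:=C2) G (locally (T:=C2) (t, z)) -> cdiff (fun s => snd (G (t + (s - s0) * a, z + (s - s0) * b))) s0.
Proof.
intros Ha Hb [l [Hl H]]. apply cdiff_iff. exists (snd (l (a, b))). intros e He.
assert (He2 : (0 < e / 2)%R) by lra.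
assert (Hlim : is_filter_lim (locally (T:=C2) (t, z)) (t, z)) by (intros P HP; exact HP).
specialize (H (t, z) Hlim (mkposreal _ He2)). apply locally_C2 in H. destruct H as [d [Hd H]].
exists d. split; [exact Hd|]. intros y Hy. set (s := y - s0) in *.
assert (Hsm : forall c, (Cmod c <= 1)%R -> (Cmod (s * c) <= Cmod s)%R).
{ intros c Hc. rewrite Cmod_mult. pose proof (Cmod_ge_0 s). nra. }
pose proof (Hsm a Ha) as Hsa. pose proof (Hsm b Hb) as Hsb.
specialize (H (t + s * a) (z + s * b)).
replace (t + s * a - t) with (s * a) in H by ring. replace (z + s * b - z) with (s * b) in H by ring.
specialize (H ltac:(lra) ltac:(lra)).
replace (s0 - s0) with (RtoC 0) by ring. replace (t + 0 * a) with t by ring. replace (z + 0 * b) with z by ring.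
assert (E : minus (G:=C2) (t + s * a, z + s * b) (t, z) = scal (V:=C2) s (a, b)).
{ apply injective_projections; [change (t + s * a - t = s * a)|change (z + s * b - z = s * b)]; ring. }
rewrite E in H.
rewrite (linear_scal l Hl) in H.
set (p := G (t + s * a, z + s * b)) in *. set (q := G (t, z)) in *. set (L := l (a, b)) in *.
eapply Rle_trans; [|eapply Rle_trans; [exact H|]].
- eapply Rle_trans; [|apply (proj1 (norm_prod _ _))].
  eapply Rle_trans; [|apply Rmax_r]. apply Req_le.
  change (Cmod (snd p - snd q - snd L * s) = Cmod (snd p - snd q - s * snd L)). f_equal. ring.
- simpl. replace (e * Cmod s)%R with (e / 2 * (2 * Cmod s))%R by field. apply Rmult_le_compat_l; [lra|].
  eapply Rle_trans; [apply (proj2 (norm_prod _ _))|].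
  assert (Hs : (sqrt 2 <= 2)%R). { rewrite <- (sqrt_Rsqr 2) at 2 by lra. apply sqrt_le_1_alt. unfold Rsqr; lra. }
  apply Rmult_le_compat; [apply sqrt_pos| |exact Hs|].
  + eapply Rle_trans; [|apply Rmax_l]. apply norm_ge_0.
  + apply Rmax_lub; assumption.
Qed.

Section Skew.
Variables (U : C2 -> Prop) (f : C -> C -> C).
Hypothesis U_open : open U.
Hypothesis U_0 : U (RtoC 0, RtoC 0).
Hypothesis F_hol : holomorphic_on U (skew f).
Hypothesis f_special : forall t : C, U (t, RtoC 0) -> special (f t).

Lemma f_diff_z t z : U (t, z) -> cdiff (f t) z.
Proof.
intros H. apply (ex_derive_ext (fun s => snd (skew f (t + (s - z) * 0, z + (s - z) * 1)))).
- intros s. simpl. f_equal; ring.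
- apply cdiff_directional; [rewrite Cmod_0; lra|rewrite Cmod_1; lra|apply F_hol, H].
Qed.

Lemma f_diff_t t z : U (t, z) -> cdiff (fun s => f s z) t.
Proof.
intros H. apply (ex_derive_ext (fun s => snd (skew f (t + (s - t) * 1, z + (s - t) * 0)))).
- intros s. simpl. f_equal; ring.
- apply cdiff_directional; [rewrite Cmod_1; lra|rewrite Cmod_0; lra|apply F_hol, H].
Qed.

Lemma f_bounded_near_0 : exists r M : R, (0 < r <= 1)%R /\ (0 <= M)%R /\ forall t z, (Cmod t <= r)%R -> (Cmod z <= r)%R ->
  U (t, z) /\ (Cmod (f t z) <= M)%R.
Proof.
destruct (locally_C2 0 0 U (U_open _ U_0)) as [e1 [He1 H1]].
pose proof (filterdiff_continuous (skew f) (RtoC 0, RtoC 0) (F_hol _ U_0)) as Hc.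
set (y0 := skew f (RtoC 0, RtoC 0)) in *.
assert (Hb : locally y0 (fun p : C2 => (Cmod (snd p - snd y0) < sqrt 2 * 1)%R)).
{ exists (mkposreal 1 Rlt_0_1). intros p [_ Hp]. apply (C_NormedModule_mixin_compat2 _ _ (mkposreal 1 Rlt_0_1)). exact Hp. }
specialize (Hc _ Hb). apply locally_C2 in Hc. destruct Hc as [e2 [He2 H2]].
set (r := Rmin 1 (Rmin (e1 / 2) (e2 / 2))).
assert (Hr : (0 < r)%R) by (repeat apply Rmin_pos; lra).
assert (Hr1 : (r <= 1)%R) by apply Rmin_l.
assert (Hr2 : (r <= e1 / 2)%R) by (eapply Rle_trans; [apply Rmin_r|apply Rmin_l]).
assert (Hr3 : (r <= e2 / 2)%R) by (eapply Rle_trans; [apply Rmin_r|apply Rmin_r]).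
exists r, (Cmod (snd y0) + sqrt 2 * 1)%R. pose proof (sqrt_pos 2). pose proof (Cmod_ge_0 (snd y0)).
split; [lra|]. split; [lra|]. intros t z Ht Hz.
assert (E : forall x, x - 0 = x) by (intros; ring).
split.
- apply H1; rewrite E; lra.
- specialize (H2 t z). rewrite !E in H2. specialize (H2 ltac:(lra) ltac:(lra)). simpl in H2.
  pose proof (Cmod_ge_sub (f t z) (snd y0)). simpl in *. lra.
Qed.

(** The constant in the definition of a special map depends on [t], but the
    remainders are bounded on a fixed bidisc, so [schwarz_order] gives a common
    constant. *)
Lemma special_uniform : exists r A : R, (0 < r <= 1)%R /\ (1 <= A)%R /\
  forall t z, (Cmod t <= r)%R -> (Cmod z <= r)%R ->
  U (t, z) /\ (Cmod (f t z - (z + z ^ 2 + z ^ 3)) <= A * Cmod z ^ 4)%R.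
Proof.
destruct f_bounded_near_0 as [r [M [Hr [HM Hf]]]].
set (A := (12 * (M + 3) * (2 / r) ^ 4 + 1)%R).
assert (HA : (0 <= 12 * (M + 3) * (2 / r) ^ 4)%R).
{ apply Rmult_le_pos; [lra|]. apply pow_le. left. apply Rdiv_lt_0_compat; lra. }
exists (r / 2)%R, A. split; [lra|]. split; [unfold A; lra|].
intros t z Ht Hz. destruct (Hf t z ltac:(lra) ltac:(lra)) as [HU _]. split; [exact HU|].
destruct (f_special t) as [K HK]. { apply Hf; [lra|rewrite Cmod_0; lra]. }
apply locally_Cmod in HK. destruct HK as [d [Hd HK]].
pose proof (schwarz_order (fun x => f t x - (x + x ^ 2 + x ^ 3)) r (M + 3) K d 4 ltac:(lra)) as Hs.
eapply Rle_trans; [apply (Hs)|].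
- intros x Hx. destruct (Hf t x ltac:(lra) Hx) as [HUx Hfx]. split.
  + apply (cdiff_minus (f t) (fun x => x + x ^ 2 + x ^ 3)); [apply f_diff_z, HUx|].
    apply (cdiff_plus (fun x => x + x ^ 2) (fun x => x ^ 3)); [|apply (cdiff_pow (fun x => x)), cdiff_id].
    apply (cdiff_plus (fun x => x) (fun x => x ^ 2)); [apply cdiff_id|apply (cdiff_pow (fun x => x)), cdiff_id].
  + eapply Rle_trans; [apply Cmod_sub_le|]. apply Rplus_le_compat; [exact Hfx|].
    eapply Rle_trans; [apply Cmod_triangle|]. eapply Rle_trans; [apply Rplus_le_compat_r, Cmod_triangle|].
    rewrite !Cmod_pow. assert (Hx1 : (0 <= Cmod x <= 1)%R) by (split; [apply Cmod_ge_0|lra]).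
    pose proof (pow_incr _ _ 2 Hx1) as P2. pose proof (pow_incr _ _ 3 Hx1) as P3. rewrite pow1 in P2, P3. lra.
- exact Hd.
- intros x Hx. apply HK. replace (x - 0) with x by ring. exact Hx.
- exact Hz.
- rewrite Rpow_mult_distr. unfold A. pose proof (pow_le (Cmod z) 4 (Cmod_ge_0 z)). nra.
Qed.

(** The map [f t] in the coordinate [w = 1 / z]. *)
Definition at_infinity (t w : C) : C := / f t (/ w).

(** If [g] is the remainder [f t z - (z + z^2 + z^3)], then
    [1 / f t z - 1 / z + 1 = (z^4 - (1 - z) g) / (z * f t z)],
    where the numerator is [O(z^4)] and the denominator is of order [z^2]. *)
Lemma at_infinity_near_translation : exists R0 A r : R, (1 <= R0)%R /\ (0 < A)%R /\ (0 < r)%R /\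
  (forall t w, (Cmod t <= r)%R -> (R0 <= Cmod w)%R ->
     U (t, / w) /\ f t (/ w) <> 0 /\ (Cmod (at_infinity t w - (w - 1)) <= A / (Cmod w * Cmod w))%R).
Proof.
destruct special_uniform as [r [A [Hr [HA Hf]]]].
set (R0 := (/ r + 2 * (2 + A))%R).
assert (Hri : (0 < / r)%R) by (apply Rinv_0_lt_compat; lra).
exists R0, (2 * (1 + 2 * A))%R, r. split; [unfold R0; lra|]. split; [lra|]. split; [lra|].
intros t w Ht Hw. unfold R0 in Hw.
assert (Hw0 : w <> 0) by (apply Cmod_pos_neq_0; lra).
set (z := / w). assert (Hz0 : z <> 0).
{ unfold z. intro E. apply C1_nz. rewrite <- (Cinv_r w Hw0), E. ring. }
assert (Hzw : Cmod z = (/ Cmod w)%R) by (unfold z; apply Cmod_inv, Hw0).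
assert (Hwz : w = / z) by (unfold z; field; exact Hw0).
set (m := Cmod z) in *.
assert (Hm0 : (0 < m)%R) by (apply Cmod_gt_0, Hz0).
assert (Hm1 : (m <= r)%R).
{ rewrite Hzw, <- (Rinv_inv r). apply Rinv_le_contravar; lra. }
assert (Hm2 : (m * (2 * (2 + A)) <= 1)%R).
{ rewrite Hzw. apply (Rmult_le_reg_l (Cmod w)); [lra|]. rewrite <- Rmult_assoc, Rinv_r; lra. }
destruct (Hf t z Ht Hm1) as [HU Hg]. split; [exact HU|]. fold m in Hg.
set (g := f t z - (z + z ^ 2 + z ^ 3)) in *.
assert (Ef : f t z = z + (z ^ 2 + z ^ 3 + g)) by (unfold g; ring).
assert (Hlow : (m / 2 <= Cmod (f t z))%R).
{ rewrite Ef. pose proof (Cmod_ge_sub z (- (z ^ 2 + z ^ 3 + g))) as Q. rewrite Cmod_opp in Q.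
  replace (z - - (z ^ 2 + z ^ 3 + g)) with (z + (z ^ 2 + z ^ 3 + g)) in Q by ring.
  pose proof (Cmod_triangle (z ^ 2 + z ^ 3) g) as Q1. pose proof (Cmod_triangle (z ^ 2) (z ^ 3)) as Q2.
  rewrite !Cmod_pow in Q2. fold m in Q, Q2.
  assert (Hm3 : (m ^ 2 + m ^ 3 + A * m ^ 4 <= m / 2)%R).
  { assert (m ^ 3 <= m ^ 2)%R by nra. assert (m ^ 4 <= m ^ 2)%R by nra.
    assert (A * m ^ 4 <= A * m ^ 2)%R by nra. nra. }
  lra. }
assert (Hfn : f t z <> 0) by (apply Cmod_pos_neq_0; lra).
split; [exact Hfn|]. unfold at_infinity. fold z.
assert (E : / f t z - (w - 1) = (z ^ 4 - (1 - z) * g) / (z * f t z)).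
{ rewrite Hwz. unfold g. field. auto. }
rewrite E, Cmod_div by (apply Cmult_neq_0; auto). rewrite Cmod_mult. fold m.
assert (Hnum : (Cmod (z ^ 4 - (1 - z) * g) <= (1 + 2 * A) * m ^ 4)%R).
{ eapply Rle_trans; [apply Cmod_sub_le|]. rewrite Cmod_pow, Cmod_mult. fold m.
  pose proof (Cmod_sub_le 1 z) as Q. rewrite Cmod_1 in Q. fold m in Q. pose proof (Cmod_ge_0 g). pose proof (Cmod_ge_0 (1 - z)).
  assert (Cmod (1 - z) * Cmod g <= 2 * (A * m ^ 4))%R by (apply Rmult_le_compat; lra). lra. }
replace (2 * (1 + 2 * A) / (Cmod w * Cmod w))%R with (2 * (1 + 2 * A) * (m * m))%R.
2:{ rewrite Hzw. field. lra. }
apply (Rmult_le_reg_r (m * Cmod (f t z))); [nra|].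
unfold Rdiv. rewrite Rmult_assoc, Rinv_l, Rmult_1_r by nra.
eapply Rle_trans; [exact Hnum|].
replace ((1 + 2 * A) * m ^ 4)%R with (2 * (1 + 2 * A) * (m * m) * (m * (m / 2)))%R by field.
apply Rmult_le_compat_l; nra.
Qed.

Lemma Cmod_ge_Re w : (Re w <= Cmod w)%R.
Proof. eapply Rle_trans; [apply Rle_abs|apply re_le_Cmod]. Qed.

(** The Lipschitz bounds are Cauchy estimates for the perturbation, on a disc of
    radius 1 in [w] (points further apart than 1/2 are covered by the bound on the
    perturbation itself) and on the disc of radius [r] in [t]. *)
Lemma at_infinity_dynamics : exists R0 A r : R, (1 <= R0)%R /\ (0 < A)%R /\ (0 < r)%R /\
  (forall t w, (Cmod t <= r)%R -> (R0 <= Re w)%R -> U (t, / w) /\ f t (/ w) <> 0) /\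
  (forall (x : R) t w, (R0 <= x)%R -> (x <= Re w)%R -> (Cmod t <= r)%R ->
     (Cmod (at_infinity t w - (w - 1)) <= A / (x * x))%R) /\
  (forall (x : R) t w w', (R0 <= x)%R -> (x <= Re w)%R -> (x <= Re w')%R -> (Cmod t <= r)%R ->
     (Cmod (at_infinity t w - at_infinity 0 w' - (w - w')) <= A * (Cmod (w - w') + Cmod t) / (x * x))%R) /\
  (forall w, (R0 <= Re w)%R -> cdiff (at_infinity 0) w).
Proof.
destruct at_infinity_near_translation as [R1 [B [r [HR1 [HB [Hr H]]]]]].
set (E := fun t w => at_infinity t w - (w - 1)).
assert (HE : forall (x : R) t w, (R1 <= x)%R -> (x <= Re w)%R -> (Cmod t <= r)%R -> (Cmod (E t w) <= B / (x * x))%R).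
{ intros x t w Hx Hw Ht. pose proof (Cmod_ge_Re w). destruct (H t w Ht ltac:(lra)) as [_ [_ Hb]].
  eapply Rle_trans; [exact Hb|]. apply Rmult_le_compat_l; [lra|]. apply Rinv_le_contravar; nra. }
assert (Hw0 : forall w, (R1 <= Re w)%R -> w <> 0).
{ intros w Hw. apply Cmod_pos_neq_0. pose proof (Cmod_ge_Re w). lra. }
assert (Hdw : forall t w, (Cmod t <= r)%R -> (R1 <= Re w)%R -> cdiff (at_infinity t) w).
{ intros t w Ht Hw. pose proof (Cmod_ge_Re w). destruct (H t w Ht ltac:(lra)) as [HU [Hn _]]. unfold at_infinity.
  apply (cdiff_inv (fun w => f t (/ w))); [|exact Hn]. apply (cdiff_comp (f t) Cinv); [apply f_diff_z, HU|].
  apply cdiff_inv_id, Hw0, Hw. }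
assert (Hdt : forall t w, (Cmod t <= r)%R -> (R1 <= Re w)%R -> cdiff (fun s => E s w) t).
{ intros t w Ht Hw. pose proof (Cmod_ge_Re w). destruct (H t w Ht ltac:(lra)) as [HU [Hn _]]. unfold E, at_infinity.
  apply (cdiff_minus (fun s => / f s (/ w)) (fun _ => w - 1)); [|apply cdiff_const].
  apply (cdiff_inv (fun s => f s (/ w))); [|exact Hn]. apply f_diff_t, HU. }
assert (HEw : forall (x : R) w w', (R1 + 1 <= x)%R -> (x <= Re w)%R -> (x <= Re w')%R ->
  (Cmod (E 0 w - E 0 w') <= 96 * B * Cmod (w - w') / (x * x))%R).
{ intros x w w' Hx Hw Hw'. assert (H0 : (Cmod 0 <= r)%R) by (rewrite Cmod_0; lra).
  pose proof (Cmod_ge_0 (w - w')) as Hp.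
  (* [E 0] is bounded by [B / (x - 1)^2 <= 4 B / x^2] on the unit disc around [w']. *)
  destruct (Rle_or_lt (Cmod (w - w')) (1 / 2)) as [Hs|Hs].
  - destruct (cauchy_expansion (E 0) w' 1 (B / ((x - 1) * (x - 1))) Rlt_0_1) as [d Hd].
    { intros y Hy. apply Re_near in Hy. split.
      - apply (cdiff_minus (at_infinity 0) (fun w => w - 1)); [apply Hdw; lra|].
        apply (cdiff_minus (fun w => w) (fun _ => 1)); [apply cdiff_id|apply cdiff_const].
      - apply HE; lra. }
    destruct (Hd w Hs) as [Hl _]. eapply Rle_trans; [exact Hl|].
    replace (24 * (B / ((x - 1) * (x - 1))) / 1 * Cmod (w - w'))%R with (24 * B * Cmod (w - w') * / ((x - 1) * (x - 1)))%R by (field; lra).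
    replace (96 * B * Cmod (w - w') / (x * x))%R with (24 * B * Cmod (w - w') * (4 / (x * x)))%R by (field; lra).
    apply Rmult_le_compat_l; [nra|]. replace (4 / (x * x))%R with (/ ((x / 2) * (x / 2)))%R by (field; lra).
    apply Rinv_le_contravar; nra.
  - eapply Rle_trans; [apply Cmod_sub_le|].
    pose proof (HE x 0 w ltac:(lra) Hw H0). pose proof (HE x 0 w' ltac:(lra) Hw' H0).
    assert (Hi : (0 < B / (x * x))%R) by (apply Rdiv_lt_0_compat; nra).
    replace (96 * B * Cmod (w - w') / (x * x))%R with (96 * Cmod (w - w') * (B / (x * x)))%R by (field; lra). nra. }
assert (HEt : forall (x : R) t w, (R1 <= x)%R -> (x <= Re w)%R -> (Cmod t <= r / 2)%R ->
  (Cmod (E t w - E 0 w) <= 24 * B / r * Cmod t / (x * x))%R).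
{ intros x t w Hx Hw Ht.
  destruct (cauchy_expansion (fun s => E s w) 0 r (B / (x * x)) Hr) as [d Hd].
  { intros y Hy. replace (y - 0) with y in Hy by ring. split; [apply Hdt; lra|apply HE; lra]. }
  destruct (Hd t) as [Hl _]; [replace (t - 0) with t by ring; exact Ht|].
  replace (t - 0) with t in Hl by ring. eapply Rle_trans; [exact Hl|]. apply Req_le. field. lra. }
exists (R1 + 1)%R, (96 * B + 24 * B / r)%R, (r / 2)%R.
assert (HBr : (0 < 24 * B / r)%R) by (apply Rdiv_lt_0_compat; lra).
split; [lra|]. split; [lra|]. split; [lra|]. split; [|split; [|split]].
- intros t w Ht Hw. pose proof (Cmod_ge_Re w). destruct (H t w ltac:(lra) ltac:(lra)) as [HU [Hn _]]. auto.
- intros x t w Hx Hw Ht. eapply Rle_trans; [apply (HE x); lra|]. apply Rmult_le_compat_r; [|lra].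
  left. apply Rinv_0_lt_compat. nra.
- intros x t w w' Hx Hw Hw' Ht.
  replace (at_infinity t w - at_infinity 0 w' - (w - w')) with ((E t w - E 0 w) + (E 0 w - E 0 w')) by (unfold E; ring).
  eapply Rle_trans; [apply Cmod_triangle|].
  pose proof (HEt x t w ltac:(lra) Hw Ht) as Q1. pose proof (HEw x w w' ltac:(lra) Hw Hw') as Q2.
  pose proof (Cmod_ge_0 (w - w')). pose proof (Cmod_ge_0 t).
  eapply Rle_trans; [apply Rplus_le_compat; [exact Q1|exact Q2]|].
  set (c := (24 * B / r)%R) in *. set (D := Cmod (w - w')) in *.
  assert (Hi : (0 < / (x * x))%R) by (apply Rinv_0_lt_compat; nra).
  assert (Hc : (c * Cmod t + 96 * B * D <= (96 * B + c) * (D + Cmod t))%R) by nra.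
  unfold Rdiv. nra.
- intros w Hw. apply Hdw; [rewrite Cmod_0; lra|lra].
Qed.
End Skew.

(** * The parametrization of the unstable manifold *)

Lemma Cinv_involutive (x : C) : x <> 0 -> / / x = x.
Proof. intros Hx. field. exact Hx. Qed.

(** Inversion maps the disc [V eps], whose boundary passes through 0, to a
    half-plane. *)
Lemma V_inv eps t : (0 < eps)%R -> V eps t -> t <> 0 /\ (/ (2 * eps) < Re (/ t))%R.
Proof.
unfold V. intros He Ht.
assert (H : (Cmod (t - eps) ^ 2 < eps ^ 2)%R).
{ pose proof (Cmod_ge_0 (t - eps)). nra. }
rewrite Cmod2_alt in H. destruct t as [a b]. unfold Re, Im in *. simpl in H.
assert (Hab : (a * a + b * b < 2 * eps * a)%R) by nra.
assert (Ha : (0 < a)%R) by nra.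
split.
- intros E. injection E. lra.
- simpl. rewrite !Rmult_1_r.
  assert (Hp : (0 < a * a + b * b)%R) by nra.
  apply (Rmult_lt_reg_r (2 * eps * (a * a + b * b))); [nra|].
  replace (/ (2 * eps) * (2 * eps * (a * a + b * b)))%R with (a * a + b * b)%R by (field; lra).
  replace (a / (a * a + b * b) * (2 * eps * (a * a + b * b)))%R with (2 * eps * a)%R by (field; lra). exact Hab.
Qed.

(** In the coordinate [1 / t] the map [t -> t / (1 + c t)] is the translation by
    [c]. *)
Lemma mobius_inv (t c : C) : t <> 0 -> / t + c <> 0 -> t / (1 + c * t) = / (/ t + c).
Proof.
intros Ht Hc. assert (E : 1 + c * t = t * (/ t + c)) by (field; exact Ht).
rewrite E. clear E. set (s := / t + c) in *. clearbody s. field. auto.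
Qed.

Section Assembly.
Variables (U : C2 -> Prop) (f : C -> C -> C).
Hypothesis U_open : open U.
Hypothesis U_0 : U (RtoC 0, RtoC 0).
Hypothesis F_hol : holomorphic_on U (skew f).
Hypothesis f_special : forall t : C, U (t, RtoC 0) -> special (f t).

Lemma f0_fixes_0 : f 0 0 = 0.
Proof.
destruct (f_special 0 U_0) as [M HM]. apply locally_singleton in HM.
replace (f 0 0 - (0 + 0 ^ 2 + 0 ^ 3)) with (f 0 0) in HM by ring. rewrite Cmod_0 in HM.
apply Cmod_eq_0, Rle_antisym; [|apply Cmod_ge_0]. simpl in HM. lra.
Qed.

(** The deviation [f 0 z - z] is [O(z^2)], so its Lipschitz constant on a disc of
    radius [rho] is [O(rho)] by the Cauchy estimate on a disc of radius
    [4 * rho]. *)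
Lemma f0_near_identity : exists rho : R, (0 < rho)%R /\
  (forall x, (Cmod x <= rho)%R -> U (RtoC 0, x)) /\
  (forall x y, (Cmod x <= rho)%R -> (Cmod y <= rho)%R -> (Cmod (f 0 x - f 0 y - (x - y)) <= / 2 * Cmod (x - y))%R).
Proof.
destruct (special_uniform U f U_open U_0 F_hol f_special) as [r [A [Hr [HA Hf]]]].
assert (H0 : (Cmod 0 <= r)%R) by (rewrite Cmod_0; lra).
set (rho := Rmin (r / 5) (/ (300 * (2 + A)))).
assert (Hi : (0 < / (300 * (2 + A)))%R) by (apply Rinv_0_lt_compat; lra).
assert (Hrho : (0 < rho)%R) by (apply Rmin_pos; lra).
assert (Hrho1 : (rho <= r / 5)%R) by apply Rmin_l.
assert (Hrho2 : (300 * (2 + A) * rho <= 1)%R).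
{ apply (Rmult_le_reg_l (/ (300 * (2 + A)))); [exact Hi|]. rewrite <- Rmult_assoc, Rinv_l, Rmult_1_l, Rmult_1_r by lra. apply Rmin_r. }
exists rho. split; [exact Hrho|]. split; [intros x Hx; apply Hf; lra|].
intros x y Hx Hy.
set (e := fun z => f 0 z - z).
destruct (cauchy_expansion e y (4 * rho) (25 * (2 + A) * (rho * rho)) ltac:(lra)) as [d Hd].
{ intros z Hz. assert (Hz5 : (Cmod z <= 5 * rho)%R) by (pose proof (Cmod_ge_sub z y); lra).
  destruct (Hf 0 z H0 ltac:(lra)) as [HU Hb]. split.
  - apply (cdiff_minus (f 0) (fun z => z)); [apply (f_diff_z U f F_hol), HU|apply cdiff_id].
  - unfold e. replace (f 0 z - z) with (z ^ 2 + z ^ 3 + (f 0 z - (z + z ^ 2 + z ^ 3))) by ring.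
    eapply Rle_trans; [apply Cmod_triangle|]. eapply Rle_trans; [apply Rplus_le_compat; [apply Cmod_triangle|exact Hb]|].
    rewrite !Cmod_pow. set (m := Cmod z) in *. assert (Hm : (0 <= m)%R) by apply Cmod_ge_0.
    assert (m ^ 3 <= m ^ 2)%R by nra. assert (m ^ 4 <= m ^ 2)%R by nra.
    assert (m ^ 2 <= 25 * (rho * rho))%R by nra. nra. }
destruct (Hd x) as [Hl _].
{ pose proof (Cmod_sub_le x y). lra. }
replace (f 0 x - f 0 y - (x - y)) with (e x - e y) by (unfold e; ring).
eapply Rle_trans; [exact Hl|]. apply Rmult_le_compat_r; [apply Cmod_ge_0|].
replace (24 * (25 * (2 + A) * (rho * rho)) / (4 * rho))%R with (150 * (2 + A) * rho)%R by (field; lra). lra.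
Qed.

(** The first coordinate after [k] steps of the orbit that starts at
    [phi_start n (1 / tau)]. *)
Definition base_orbit (tau : C) (n k : nat) : C := / (tau + INR (S n + k)).

(** The skew product, in the coordinates at infinity, translates the base by 1 and
    applies [at_infinity f] in the fibre; the orbit stays in the half-plane where
    these coordinates are valid. *)
Lemma skew_iterates (R0 A r : R) (t : C) (n : nat) : (1 <= R0)%R -> (0 < A)%R -> (0 < r)%R ->
  (forall t w, (Cmod t <= r)%R -> (R0 <= Re w)%R -> U (t, / w) /\ f t (/ w) <> 0) ->
  (forall (x : R) t w, (R0 <= x)%R -> (x <= Re w)%R -> (Cmod t <= r)%R ->
     (Cmod (at_infinity f t w - (w - 1)) <= A / (x * x))%R) ->
  t <> 0 -> (abscissa A R0 <= Re (/ t))%R -> (forall k, (Cmod (base_orbit (/ t) n k) <= r)%R) ->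
  forall k, (k <= n)%nat -> Nat.iter k (skew f) (phi_start n t) =
    (base_orbit (/ t) n k, / orbit (at_infinity f) (base_orbit (/ t) n) (/ t + INR n) k) /\
    U (base_orbit (/ t) n k, / orbit (at_infinity f) (base_orbit (/ t) n) (/ t + INR n) k).
Proof.
intros HR0 HA Hr HfU HG Ht Hx Hb.
assert (Hn0 : forall m : nat, / t + INR m <> 0).
{ intros m. apply Cmod_pos_neq_0. pose proof (Cmod_ge_Re (/ t + INR m)) as Q. rewrite Re_plus_INR in Q.
  pose proof (pos_INR m). unfold abscissa in Hx. lra. }
assert (HUk : forall k, (k <= n)%nat ->
  U (base_orbit (/ t) n k, / orbit (at_infinity f) (base_orbit (/ t) n) (/ t + INR n) k) /\
  f (base_orbit (/ t) n k) (/ orbit (at_infinity f) (base_orbit (/ t) n) (/ t + INR n) k) <> 0).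
{ intros k Hk. apply HfU; [apply Hb|].
  destruct (orbit_region (at_infinity f) A R0 r HA HR0 HG (base_orbit (/ t) n) (/ t) (/ t + INR n) (Re (/ t)) n Hb
    ltac:(lra) (start_exact A R0 HA HR0 _ _ _ Hx) k Hk) as [_ Q].
  pose proof (pos_INR (n - k)). unfold abscissa in Hx. lra. }
intros k Hk. split; [|apply HUk, Hk].
induction k.
- simpl. unfold phi_start, base_orbit. rewrite Nat.add_0_r. f_equal; apply mobius_inv; auto.
- rewrite Nat.iter_succ, IHk by lia. destruct (HUk k ltac:(lia)) as [_ Hf].
  unfold skew. simpl fst; simpl snd. f_equal.
  + unfold base_orbit. replace (S n + S k)%nat with (S (S n + k)) by lia. rewrite S_INR, RtoC_plus.
    pose proof (Hn0 (S n + k)%nat) as Q1. pose proof (Hn0 (S (S n + k))) as Q2. rewrite S_INR, RtoC_plus in Q2.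
    set (s := / t + INR (S n + k)) in *. replace (/ t + (INR (S n + k) + 1)) with (s + 1) in * by (unfold s; ring).
    field. auto.
  + simpl. unfold at_infinity at 1. symmetry. apply Cinv_involutive, Hf.
Qed.
End Assembly.

Theorem theorem3p1 (U : C2 -> Prop) (f : C -> C -> C)
    (U_open : open U) (U_0 : U (RtoC 0, RtoC 0))
    (F_hol : holomorphic_on U (skew f))
    (f_special : forall t : C, U (t, RtoC 0) -> special (f t)) :
  let D0 := fun z : C => U (RtoC 0, z) in
  (exists (N W : C -> Prop) (g : C -> C), local_inverse D0 (f 0) N W g) /\
  (forall (N W : C -> Prop) (g : C -> C), local_inverse D0 (f 0) N W g ->
     exists eps0 : R, (0 < eps0)%R /\
       forall eps : R, (0 < eps < eps0)%R ->
         exists phi : C -> C,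
           (forall t : C, V eps t ->
              (forall n : nat, iter_defined U (skew f) n (phi_start n t)) /\
              filterlim (fun n : nat => phi_seq f n t)
                eventually (locally (phi t))) /\
           parametrization D0 (f 0) (unstable_manifold W g) (V eps) phi).
Proof.
intros D0. split.
{ destruct (f0_near_identity U f U_open U_0 F_hol f_special) as [rho [Hrho [HU Hc]]].
  apply (local_inverse_exists D0 (f 0) rho Hrho (f0_fixes_0 U f U_0 f_special) HU Hc). }
intros N W g [N_open [N_0 [W_open [W_0 [HN HW]]]]].
apply N_open, locally_Cmod in N_0. destruct N_0 as [d1 [Hd1 N_0]].
apply W_open, locally_Cmod in W_0. destruct W_0 as [d2 [Hd2 W_0]].
destruct (at_infinity_dynamics U f U_open U_0 F_hol f_special) as [R0 [A [r [HR0 [HA [Hr [HfU [HG1 [HG2 HG3]]]]]]]]].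
destruct (functional_choice (fun tau p => (abscissa A R0 <= Re tau)%R -> converges (fun n => psi_approx (at_infinity f) n tau) p)) as [psi Hpsi].
{ intros tau. destruct (Rle_dec (abscissa A R0) (Re tau)) as [H|H].
  - destruct (psi_approx_converges (at_infinity f) A R0 r HA HR0 Hr HG1 HG2 tau H) as [p Hp]. exists p. auto.
  - exists 0. intros H'. contradiction. }
(* For [Re tau >= X], the point [1 / psi tau] lies in [N] and in [W], the points of
   the base orbit have modulus at most [r], and [psi] is holomorphic. *)
set (X := (abscissa A R0 + 1 + / r + / d1 + / d2)%R).
assert (Hri : (0 < / r)%R) by (apply Rinv_0_lt_compat; lra).
assert (Hdi1 : (0 < / d1)%R) by (apply Rinv_0_lt_compat; lra).
assert (Hdi2 : (0 < / d2)%R) by (apply Rinv_0_lt_compat; lra).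
assert (HX0 : (8 / 2 <= abscissa A R0)%R) by (unfold abscissa; lra).
exists (/ (2 * X))%R. split; [apply Rinv_0_lt_compat; unfold X; lra|].
intros eps Heps.
assert (HX : forall t, V eps t -> t <> 0 /\ (X < Re (/ t))%R).
{ intros t Ht. destruct (V_inv eps t ltac:(lra) Ht) as [H1 H2]. split; [exact H1|].
  eapply Rle_lt_trans; [|exact H2].
  assert (H : (2 * eps <= / X)%R). { rewrite Rinv_mult in Heps. lra. }
  rewrite <- (Rinv_inv X). apply Rinv_le_contravar; lra. }
assert (Hnear : forall tau, (X <= Re tau)%R -> (/ d1 < Re (psi tau))%R /\ (/ d2 < Re (psi tau))%R /\ (1 < Re (psi tau))%R /\ (R0 <= Re (psi tau))%R).
{ intros tau Htau. pose proof (psi_Re (at_infinity f) A R0 r HA HR0 Hr HG1 psi Hpsi tau ltac:(unfold X in *; lra)) as Q.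
  unfold X, abscissa in *. lra. }
assert (Hpn : forall tau, (X <= Re tau)%R -> psi tau <> 0).
{ intros tau Htau. apply Cmod_pos_neq_0. pose proof (Cmod_ge_Re (psi tau)). destruct (Hnear tau Htau) as [_ [_ [Q _]]]. lra. }
assert (Hinv : forall (d : R) w, (0 < d)%R -> (/ d < Re w)%R -> (Cmod (/ w - 0) < d)%R).
{ intros d w Hd Hw. assert (0 < / d)%R by (apply Rinv_0_lt_compat, Hd). pose proof (Cmod_ge_Re w).
  replace (/ w - 0) with (/ w) by ring. rewrite Cmod_inv by (apply Cmod_pos_neq_0; lra).
  rewrite <- (Rinv_inv d). apply Rinv_lt_contravar; [|lra]. apply Rmult_lt_0_compat; lra. }
assert (Heq : forall tau, (X <= Re tau)%R -> / psi (tau - 1) = f 0 (/ psi tau)).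
{ intros tau Htau. rewrite (psi_equation (at_infinity f) A R0 r HA HR0 Hr HG1 HG2 psi Hpsi tau) by (unfold X in *; lra).
  unfold at_infinity. apply Cinv_involutive. apply HfU; [rewrite Cmod_0; lra|]. apply Hnear, Htau. }
exists (fun t => / psi (/ t)). split; [|split; [|split; [|split]]].
- intros t Ht. destruct (HX t Ht) as [Ht0 Hx].
  assert (Hb : forall n k, (/ r < Cmod (/ t + INR (S n + k)))%R /\ (1 + INR n <= Cmod (/ t + INR (S n + k)))%R).
  { intros n k. pose proof (Cmod_ge_Re (/ t + INR (S n + k))) as Q. rewrite Re_plus_INR in Q.
    rewrite plus_INR, S_INR in Q. rewrite plus_INR, S_INR. pose proof (pos_INR n). pose proof (pos_INR k). unfold X in Hx. lra. }
  assert (Hb1 : forall n k, (Cmod (base_orbit (/ t) n k) <= r)%R).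
  { intros n k. destruct (Hb n k) as [Q _]. unfold base_orbit. rewrite Cmod_inv by (apply Cmod_pos_neq_0; lra).
    rewrite <- (Rinv_inv r). left. apply Rinv_lt_contravar; [|exact Q]. nra. }
  assert (Hb2 : forall n k, (Cmod (base_orbit (/ t) n k) <= 1 / (1 + INR n))%R).
  { intros n k. destruct (Hb n k) as [_ Q]. pose proof (pos_INR n). unfold base_orbit. rewrite Cmod_inv by (apply Cmod_pos_neq_0; lra).
    unfold Rdiv. rewrite Rmult_1_l. apply Rinv_le_contravar; lra. }
  assert (Hxt : (abscissa A R0 <= Re (/ t))%R) by (unfold X in Hx; lra).
  pose proof (fun n => skew_iterates U f R0 A r t n HR0 HA Hr HfU HG1 Ht0 Hxt (Hb1 n)) as Hit.
  split.
  + intros n k Hk. destruct (Hit n k ltac:(lia)) as [E HU]. rewrite E. exact HU.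
  + assert (Hc : converges (fun n => orbit (at_infinity f) (base_orbit (/ t) n) (/ t + INR n) n) (psi (/ t))).
    { apply (psi_nonautonomous (at_infinity f) A R0 r HA HR0 Hr HG1 HG2 psi Hpsi); auto. }
    assert (Hs : filterlim (fun n => orbit (at_infinity f) (base_orbit (/ t) n) (/ t + INR n) n) eventually (locally (T:=C_UniformSpace) (psi (/ t)))).
    { apply filterlim_Cmod; [apply eventually_filter|]. exact Hc. }
    assert (Hci : ccont Cinv (psi (/ t))) by (apply cdiff_continuous, cdiff_inv_id, Hpn; lra).
    apply (filterlim_ext (fun n => / orbit (at_infinity f) (base_orbit (/ t) n) (/ t + INR n) n)).
    { intros n. unfold phi_seq. destruct (Hit n n ltac:(lia)) as [E _]. rewrite E. reflexivity. }
    exact (filterlim_comp _ _ _ _ Cinv _ _ _ Hs Hci).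
- intros t Ht. destruct (HX t Ht) as [Ht0 Hx]. apply cdiff_filterdiff.
  apply (cdiff_inv (fun t => psi (/ t))); [|apply Hpn; lra].
  apply (cdiff_comp psi Cinv); [|apply cdiff_inv_id, Ht0].
  apply (psi_diff (at_infinity f) A R0 r HA HR0 Hr HG1 HG3 psi Hpsi). unfold X in Hx. lra.
- intros s t Hs Ht E. destruct (HX s Hs) as [Hs0 Hxs]. destruct (HX t Ht) as [Ht0 Hxt].
  assert (E2 : psi (/ s) = psi (/ t)).
  { rewrite <- (Cinv_involutive (psi (/ s))), <- (Cinv_involutive (psi (/ t))) by (apply Hpn; lra). f_equal. exact E. }
  pose proof (psi_expanding (at_infinity f) A R0 r HA HR0 Hr HG1 HG2 psi Hpsi (/ s) (/ t)
    ltac:(unfold X in *; lra) ltac:(unfold X in *; lra)) as Q.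
  rewrite E2 in Q. replace (psi (/ t) - psi (/ t)) with (RtoC 0) in Q by ring. rewrite Cmod_0, Rmult_0_r in Q.
  assert (E3 : / s - / t = 0) by (apply Cmod_eq_0, Rle_antisym; [exact Q|apply Cmod_ge_0]).
  rewrite <- (Cinv_involutive s), <- (Cinv_involutive t) by assumption. f_equal.
  replace (/ s) with (/ s - / t + / t) by ring. rewrite E3. ring.
- intros t Ht. destruct (HX t Ht) as [Ht0 Hx].
  (* [1 / psi (tau + k + 1)] is a preimage of [1 / psi (tau + k)] that lies in [N], so
     it is the one that [g] selects. *)
  assert (Hk : forall k, Nat.iter k g (/ psi (/ t)) = / psi (/ t + INR k)).
  { induction k.
    - simpl. rewrite Cplus_0_r. reflexivity.
    - rewrite Nat.iter_succ, IHk.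
      assert (Hre : (X <= Re (/ t + INR (S k)))%R) by (rewrite Re_plus_INR; pose proof (pos_INR (S k)); lra).
      pose proof (Heq _ Hre) as E.
      replace (/ t + INR (S k) - 1) with (/ t + INR k) in E by (rewrite S_INR, RtoC_plus; ring).
      rewrite E. apply HN. apply N_0, Hinv; [exact Hd1|]. apply Hnear, Hre. }
  assert (Hre : forall k, (X <= Re (/ t + INR k))%R) by (intros k; rewrite Re_plus_INR; pose proof (pos_INR k); lra).
  split.
  + intros k. rewrite Hk. apply W_0, Hinv; [exact Hd2|]. apply Hnear, Hre.
  + apply (filterlim_Cmod eventually). intros e He.
    destruct (INR_archimed 1 (/ e) Rlt_0_1) as [n0 Hn0].
    exists n0. intros n Hn. rewrite Hk. apply Hinv; [exact He|].
    pose proof (psi_Re (at_infinity f) A R0 r HA HR0 Hr HG1 psi Hpsi (/ t + INR n)) as Q.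
    specialize (Hre n). rewrite Re_plus_INR in *. apply le_INR in Hn. unfold X in *. specialize (Q ltac:(lra)). lra.
- intros t Ht Ht'. destruct (HX t Ht) as [Ht0 Hx]. destruct (HX _ Ht') as [Ht0' Hx'].
  split.
  + destruct (HfU 0 (psi (/ t)) ltac:(rewrite Cmod_0; lra) ltac:(apply Hnear; lra)) as [Q _]. exact Q.
  (* Otherwise [t / (1 - t)] would be 0, by the value of the division by 0, but 0 is
     not in [V eps]. *)
  + assert (H1 : 1 - t <> 0).
    { intros E. apply Ht0'. unfold Cdiv. rewrite E. apply injective_projections; simpl; unfold Rdiv; ring. }
    replace (/ (t / (1 - t))) with (/ t - 1) by (field; auto). apply Heq. lra.
Qed.
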